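(* Let $(\Omega,d)$ be a strongly finite-dimensional $*$-differential calculus over a compact quantum group $G$ and suppose we have a graded, left-invariant inner product on $\Omega$. Let $d^*$ be the adjoint of $d$, $D=d+d^*$, $\nabla=D^2$ and $\Omega_\nabla=\ker(\nabla)$. Then: 1. The Dirac operator $D$ and the Laplacian $\nabla$ are diagonalisable. 2. We have $\ker(\nabla)=\ker(D)=\ker(d)\cap\ker(d^* )$ and, if $t$ is a positive eigenvalue of $\nabla$, then $$\ker(\nabla-t)=\ker(D+\sqrt t)\oplus\ker(D-\sqrt t).$$ 3. The space $\Omega$ admits the orthogonal decomposition $$\Omega=\Omega_\nabla\oplus d(\Omega)\oplus d^*(\Omega).$$
   Context: All spaces are over $\mathbb{C}$; inner products are linear in the first variable. $G=(A,\Delta)$ is a compact quantum group in the sense of Woronowicz. Its associated Hopf $*$-algebra $\mathcal{A}$ is the linear span of the matrix elements of all finite-dimensional irreducible unitary representations of $G$, with the restriction of $\Delta$; the Haar state of $G$ restricts to a positive Haar integral $h$ on $\mathcal{A}$. A $*$-differential calculus over $G$ is a $*$-differential calculus over $\mathcal{A}$, as defined next. A graded $*$-algebra is an algebra $\Omega=\bigoplus_{n\ge 0}\Omega_n$ with $\Omega_m\Omega_n\subseteq\Omega_{m+n}$ and a conjugate-linear degree-zero map $\omega\mapsto\omega^*$ with $(\omega^* )^*=\omega$ and $(\omega_1\omega_2)^*=(-1)^{kl}\omega_2^*\omega_1^*$ for $\omega_1\in\Omega_k,\omega_2\in\Omega_l$. A graded $*$-differential algebra is a pair $(\Omega,d)$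 with $\Omega$ a graded $*$-algebra and $d$ a linear map of degree $1$ with $d^2=0$, $d(\omega^* )=(d\omega)^*$ and $d(\omega'\omega)=d(\omega')\omega+(-1)^k\omega'd\omega$ for $\omega'\in\Omega_k$. A $*$-differential calculus over $\mathcal{A}$ is a graded $*$-differential algebra $(\Omega,d)$ such that: (1) $\Omega_0=\mathcal{A}$ as $*$-algebras and $\Omega_k$ ($k>0$) is the linear span of products $a_0\,da_1\cdots da_k$, $a_i\in\mathcal{A}$; (2) there is an algebra homomorphism $\Delta_\Omega:\Omega\to\mathcal{A}\otimes\Omega$ extending $\Delta$ with $(\mathrm{id}_{\mathcal{A}}\otimes d)\Delta_\Omega=\Delta_\Omega d$; (3) $d1=0$. $\Omega^{\mathrm{inv}}=\{\omega:\Delta_\Omega(\omega)=1\otimes\omega\}$ and $\Omega^{\mathrm{inv}}_k=\Omega_k\cap\Omega^{\mathrm{inv}}$. The map $a\otimes\omega\mapsto a\omega$ is an isomorphism of left $\mathcal{A}$-modules $\mathcal{A}\otimes\Omega^{\mathrm{inv}}\to\Omega$. The calculus is strongly finite dimensional if $\Omega^{\mathrm{inv}}$ is finite dimensional. An inner product on $\Omega$ is graded if the $\Omega_k$ are pairwise orthogonal, and left-invariant if $(a\omega\mid b\eta)=h(b^*a)(\omega\mid\eta)$ for $a,b\in\mathcal{A}$, $\omega,\eta\in\Omega^{\mathrm{inv}}$. For such an inner product $d$ has an adjoint $d^*$, i.e. a linear operator on $\Omega$ with $(d\omega\mid\eta)=(\omega\mid d^*\eta)$ for all $\omega,\eta\in\Omega$.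 A linear operator on a vector space $X$ is diagonalisable if $X$ has a (Hamel) basis of eigenvectors of it. *)

(* Defs.v *)
From HB Require Import structures.
From mathcomp Require Import all_boot all_order all_algebra.
From mathcomp Require Import generic_quotient complex.
From mathcomp Require Import boolp classical_sets reals.

Set Implicit Arguments.
Unset Strict Implicit.
Unset Printing Implicit Defensive.
Import Order.TTheory GRing.Theory Num.Theory.
Local Open Scope classical_set_scope.
Local Open Scope ring_scope.
Local Open Scope quotient_scope.
Local Open Scope complex_scope.

Section LinearAlgebra.
Context {K : fieldType}.
Implicit Type V : lmodType K.

Definition subspace V (X : set V) : Prop :=
  X 0 /\ forall (c : K) x y, X x -> X y -> X (c *: x + y).

Definition linear_span V (X : set V) : set V :=
  [set x | exists2 s : seq (K * V),
     (forall p, p \in s -> X p.2) & x = \sum_(p <- s) p.1 *: p.2].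

Definition is_direct_sum V (I : eqType) (X : I -> set V) (Y : set V) : Prop :=
  [/\ forall i, subspace (X i),
      forall y, Y y <-> exists (s : seq I) (x : I -> V),
        [/\ uniq s, forall i, X i (x i) & y = \sum_(i <- s) x i] &
      forall (s : seq I) (x : I -> V), uniq s -> (forall i, X i (x i)) ->
        \sum_(i <- s) x i = 0 -> forall i, i \in s -> x i = 0].

Definition finite_dimensional V (X : set V) : Prop :=
  exists s : seq V, X = linear_span [set` s].

Definition hamel_basis V (B : set V) : Prop :=
  (forall (s : seq V) (c : V -> K), uniq s -> (forall v, v \in s -> B v) ->
     \sum_(v <- s) c v *: v = 0 -> forall v, v \in s -> c v = 0)
  /\ linear_span B = setT.

Definition kernel V (T : V -> V) : set V := [set v | T v = 0].

Definition eigenvector V (T : V -> V) (t : K) (v : V) : Prop :=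
  v != 0 /\ T v = t *: v.

Definition is_eigenvalue V (T : V -> V) (t : K) : Prop :=
  exists v, eigenvector T t v.

Definition diagonalisable V (T : V -> V) : Prop :=
  exists2 B : set V, hamel_basis B &
    forall v, B v -> exists t, eigenvector T t v.

End LinearAlgebra.

(* [tens U V] is the quotient of the finite formal sums of pairs by the
   relation "every bilinear map takes the same value on both sums". *)

Definition bilinear_map (K : comNzRingType) (U V W : lmodType K)
    (b : U -> V -> W) : Prop :=
  (forall v, linear (b ^~ v)) /\ (forall u, linear (b u)).

Definition pairsum (U V : Type) (W : nmodType) (b : U -> V -> W)
    (s : seq (U * V)) : W := \sum_(p <- s) b p.1 p.2.

Section TensorDef.
Variables (K : comNzRingType) (U V : lmodType K).

Definition tens_rel (s t : seq (U * V)) : bool :=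
  `[< forall (W : lmodType K) (b : U -> V -> W),
        bilinear_map b -> pairsum b s = pairsum b t >].

Lemma tens_relP s t : reflect (forall (W : lmodType K) (b : U -> V -> W),
  bilinear_map b -> pairsum b s = pairsum b t) (tens_rel s t).
Proof. exact: asboolP. Qed.

Lemma tens_rel_refl : reflexive tens_rel.
Proof. by move=> s; apply/tens_relP. Qed.
Lemma tens_rel_sym : symmetric tens_rel.
Proof.
by move=> s t; apply/tens_relP/tens_relP => h W b bb; rewrite (h W b).
Qed.
Lemma tens_rel_trans : transitive tens_rel.
Proof.
move=> s t u /tens_relP h1 /tens_relP h2; apply/tens_relP => W b bb.
by rewrite h1 // h2.
Qed.
Canonical tens_equiv := EquivRel tens_rel tens_rel_refl tens_rel_sym
  tens_rel_trans.

Definition tens : Type := {eq_quot tens_equiv}.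
HB.instance Definition _ : EqQuotient _ tens_equiv tens :=
  EqQuotient.on tens.
HB.instance Definition _ := Choice.on tens.

Definition pure (u : U) (v : V) : tens := \pi_tens [:: (u, v)].

(* The linear map on the tensor product that corresponds to [b]; it is
   meaningful when [b] is bilinear, see [tlift_pi]. *)
Definition tlift (W : nmodType) (b : U -> V -> W) (x : tens) : W :=
  pairsum b (repr x).

Lemma tlift_pi (W : lmodType K) (b : U -> V -> W) s :
  bilinear_map b -> tlift b (\pi_tens s) = pairsum b s.
Proof.
move=> bb; rewrite /tlift.
have : \pi_tens (repr (\pi_tens s)) = \pi_tens s :> tens by rewrite reprK.
by move/eqmodP => /tens_relP; apply.
Qed.

Lemma tens_ext (x y : tens) :
  (forall (W : lmodType K) (b : U -> V -> W),
     bilinear_map b -> tlift b x = tlift b y) -> x = y.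
Proof.
move=> h; rewrite -[x]reprK -[y]reprK; apply/eqmodP/tens_relP => W b bb.
exact: h.
Qed.

Definition tzero : tens := \pi_tens [::].
Definition tadd (x y : tens) : tens := \pi_tens (repr x ++ repr y).
Definition tscale (c : K) (x : tens) : tens :=
  \pi_tens [seq (c *: p.1, p.2) | p <- repr x].
Definition topp (x : tens) : tens := tscale (-1) x.

Section Eval.
Variables (W : lmodType K) (b : U -> V -> W) (bb : bilinear_map b).

Lemma bilinDl u u' v : b (u + u') v = b u v + b u' v.
Proof. by have := bb.1 v 1 u u'; rewrite !scale1r. Qed.
Lemma bilinDr u v v' : b u (v + v') = b u v + b u v'.
Proof. by have := bb.2 u 1 v v'; rewrite !scale1r. Qed.
Lemma bilin0l v : b 0 v = 0.
Proof. by have /(congr1 (fun w => w - b 0 v)) := bilinDl 0 0 v;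
  rewrite addr0 subrr addrK => <-. Qed.
Lemma bilin0r u : b u 0 = 0.
Proof. by have /(congr1 (fun w => w - b u 0)) := bilinDr u 0 0;
  rewrite addr0 subrr addrK => <-. Qed.
Lemma bilinZl c u v : b (c *: u) v = c *: b u v.
Proof. by have := bb.1 v c u 0; rewrite !addr0 bilin0l addr0. Qed.
Lemma bilinZr c u v : b u (c *: v) = c *: b u v.
Proof. by have := bb.2 u c v 0; rewrite !addr0 bilin0r addr0. Qed.

Lemma tlift_zero : tlift b tzero = 0.
Proof. by rewrite tlift_pi // /pairsum big_nil. Qed.
Lemma tlift_add x y : tlift b (tadd x y) = tlift b x + tlift b y.
Proof. by rewrite tlift_pi // /pairsum big_cat. Qed.
Lemma tlift_scale c x : tlift b (tscale c x) = c *: tlift b x.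
Proof.
rewrite tlift_pi // /pairsum big_map scaler_sumr.
by apply: eq_bigr => p _; rewrite bilinZl.
Qed.
End Eval.

Lemma taddA : associative tadd.
Proof. by move=> x y z; apply: tens_ext => W b bb; rewrite !tlift_add // addrA. Qed.
Lemma taddC : commutative tadd.
Proof. by move=> x y; apply: tens_ext => W b bb; rewrite !tlift_add // addrC. Qed.
Lemma tadd0 : left_id tzero tadd.
Proof.
by move=> x; apply: tens_ext => W b bb; rewrite tlift_add // tlift_zero // add0r.
Qed.
Lemma taddN : left_inverse tzero topp tadd.
Proof.
move=> x; apply: tens_ext => W b bb.
by rewrite tlift_add // tlift_scale // tlift_zero // scaleN1r addNr.
Qed.
HB.instance Definition _ := GRing.isZmodule.Build tens taddA taddC tadd0 taddN.

Lemma tscaleA a b x : tscale a (tscale b x) = tscale (a * b) x.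
Proof. by apply: tens_ext => W f ff; rewrite !tlift_scale // scalerA. Qed.
Lemma tscale1 : left_id 1 tscale.
Proof. by move=> x; apply: tens_ext => W f ff; rewrite tlift_scale // scale1r. Qed.
Lemma tscaleDr : right_distributive tscale +%R.
Proof.
move=> a x y; apply: tens_ext => W f ff.
by rewrite tlift_scale // !tlift_add // !tlift_scale // scalerDr.
Qed.
Lemma tscaleDl x : {morph tscale^~ x : a b / a + b}.
Proof.
move=> a b; apply: tens_ext => W f ff.
by rewrite tlift_add // !tlift_scale // scalerDl.
Qed.
HB.instance Definition _ := GRing.Zmodule_isLmodule.Build K tens
  tscaleA tscale1 tscaleDr tscaleDl.

Lemma tlift_linear (W : lmodType K) (b : U -> V -> W) :
  bilinear_map b -> linear (tlift b).
Proof. by move=> bb c x y; rewrite tlift_add // tlift_scale. Qed.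

Lemma tlift_pure (W : lmodType K) (b : U -> V -> W) u v :
  bilinear_map b -> tlift b (pure u v) = b u v.
Proof. by move=> bb; rewrite tlift_pi // /pairsum big_seq1. Qed.

Lemma pure_bilinear : bilinear_map pure.
Proof.
split=> [v c u u'|u c v v']; apply: tens_ext => W b bb;
  rewrite tlift_linear // !tlift_pure //.
- exact: bb.1.
- exact: bb.2.
Qed.

Lemma tens_sum x : x = \sum_(p <- repr x) pure p.1 p.2.
Proof.
apply: tens_ext => W b bb.
have h : {morph tlift b : y z / y + z} by exact: tlift_add.
have h0 : tlift b 0 = 0 by exact: tlift_zero.
rewrite (big_morph _ h h0); apply: eq_bigr => p _.
by rewrite tlift_pure.
Qed.

End TensorDef.

Notation "u '⊗' v" := (pure u v) (at level 40, no associativity) : ring_scope.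

Section TensorMaps.
Variable K : comNzRingType.

Definition tmap (U V U' V' : lmodType K) (f : U -> U') (g : V -> V') :
  tens U V -> tens U' V' := tlift (fun u v => f u ⊗ g v).

Definition tassoc (U V W : lmodType K) :
  tens (tens U V) W -> tens U (tens V W) :=
  tlift (fun x w => tlift (fun u v => u ⊗ (v ⊗ w)) x).

Lemma tens_lin_ext (U V W : lmodType K) (f g : tens U V -> W) :
  linear f -> linear g -> (forall u v, f (u ⊗ v) = g (u ⊗ v)) ->
  forall x, f x = g x.
Proof.
move=> lf lg fg x.
have fD (h : tens U V -> W) : linear h ->
    {morph h : y z / y + z} /\ h 0 = 0.
  move=> lh; have hD y z : h (y + z) = h y + h z.
    by have := lh 1 y z; rewrite !scale1r.
  split=> //; have /(congr1 (fun w => w - h 0)) := hD 0 0.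
  by rewrite addr0 subrr addrK.
rewrite [x]tens_sum.
have [fM f0] := fD f lf; have [gM g0] := fD g lg.
rewrite (big_morph f fM f0) (big_morph g gM g0).
by apply: eq_bigr => p _.
Qed.

End TensorMaps.

Section TensorRing.
Variables (K : comNzRingType) (A B : algType K).
Local Notation T := (tens A B).

Definition tmul (x y : T) : T :=
  tlift (fun a b => tlift (fun c d => (a * c) ⊗ (b * d)) y) x.
Definition tone : T := 1 ⊗ 1.

Lemma tmul_inner a b :
  bilinear_map (fun c d => (a * c) ⊗ (b * d) : T).
Proof.
have [h1 h2] := @pure_bilinear K A B.
split=> [v c u u'|u c v v'] /=.
- by rewrite mulrDr -scalerAr; exact: h1.
- by rewrite mulrDr -scalerAr; exact: h2.
Qed.

Lemma tmul_outer (y : T) :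
  bilinear_map (fun a b => tlift (fun c d => (a * c) ⊗ (b * d)) y : T).
Proof.
have [h1 h2] := @pure_bilinear K A B.
split=> [v c u u'|u c v v'] /=; rewrite /tlift /pairsum scaler_sumr -big_split /=;
  apply: eq_bigr => p _; rewrite mulrDl -scalerAl;
  [exact: h1 | exact: h2].
Qed.

Lemma tmul_linl y : linear (tmul^~ y).
Proof. exact: (tlift_linear (tmul_outer y)). Qed.
Lemma tmul_linr x : linear (tmul x).
Proof.
move=> c y z; rewrite /tmul /tlift /pairsum scaler_sumr -big_split /=.
apply: eq_bigr => p _; exact: (tlift_linear (tmul_inner p.1 p.2)).
Qed.
Lemma tmul_pure a b c d : tmul (a ⊗ b) (c ⊗ d) = (a * c) ⊗ (b * d).
Proof.
rewrite /tmul tlift_pure; last exact: tmul_outer.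
by rewrite tlift_pure //; exact: tmul_inner.
Qed.

Lemma tmulA : associative tmul.
Proof.
move=> x y z.
apply: (tens_lin_ext (f := fun x => tmul x (tmul y z))
   (g := fun x => tmul (tmul x y) z)) x => [| |a b].
- exact: tmul_linl.
- by move=> c u v; rewrite tmul_linl tmul_linl.
apply: (tens_lin_ext (f := fun y => tmul (a ⊗ b) (tmul y z))
   (g := fun y => tmul (tmul (a ⊗ b) y) z)) y => [| |a' b'].
- by move=> c u v; rewrite tmul_linl tmul_linr.
- by move=> c u v; rewrite tmul_linr tmul_linl.
apply: (tens_lin_ext (f := fun z => tmul (a ⊗ b) (tmul (a' ⊗ b') z))
   (g := fun z => tmul (tmul (a ⊗ b) (a' ⊗ b')) z)) z => [| |a'' b''].
- by move=> c u v; rewrite !tmul_linr.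
- exact: tmul_linr.
by rewrite !tmul_pure !mulrA.
Qed.

Lemma tmul1l : left_id tone tmul.
Proof.
move=> x; apply: (tens_lin_ext (f := tmul tone) (g := id)) x => // [|a b].
- exact: tmul_linr.
- by rewrite tmul_pure !mul1r.
Qed.
Lemma tmul1r : right_id tone tmul.
Proof.
move=> x; apply: (tens_lin_ext (f := tmul^~ tone) (g := id)) x => // [|a b].
- exact: tmul_linl.
- by rewrite tmul_pure !mulr1.
Qed.
Lemma tmulDl : left_distributive tmul +%R.
Proof. by move=> x y z; have := tmul_linl z 1 x y; rewrite !scale1r. Qed.
Lemma tmulDr : right_distributive tmul +%R.
Proof. by move=> x y z; have := tmul_linr x 1 y z; rewrite !scale1r. Qed.

HB.instance Definition _ := GRing.Zmodule_isPzRing.Build T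
  tmulA tmul1l tmul1r tmulDl tmulDr.

End TensorRing.

HB.mixin Record isStarAlgebra (K : numClosedFieldType) A
    of GRing.Algebra K A := {
  star : A -> A;
  starK : involutive star;
  starD : {morph star : a b / a + b};
  starZ : forall (c : K) (a : A), star (c *: a) = c^* *: star a;
  starM : forall a b : A, star (a * b) = star b * star a
}.

#[short(type="starAlgType")]
HB.structure Definition StarAlgebra (K : numClosedFieldType) :=
  {A of isStarAlgebra K A & GRing.Algebra K A}.

(* Conjugate-linear maps into [V] are linear maps into [conj_mod V]. *)
Definition conj_mod (K : numClosedFieldType) (V : lmodType K) : Type := V.

Section ConjMod.
Variables (K : numClosedFieldType) (V : lmodType K).
HB.instance Definition _ := GRing.Zmodule.on (conj_mod V).
Definition conj_scale (c : K) (v : conj_mod V) : conj_mod V := c^* *: (v : V).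
Lemma conj_scaleA a b v : conj_scale a (conj_scale b v) = conj_scale (a * b) v.
Proof. by rewrite /conj_scale scalerA rmorphM. Qed.
Lemma conj_scale1 : left_id 1 conj_scale.
Proof. by move=> v; rewrite /conj_scale rmorph1 scale1r. Qed.
Lemma conj_scaleDr : right_distributive conj_scale +%R.
Proof. by move=> c u v; rewrite /conj_scale scalerDr. Qed.
Lemma conj_scaleDl v : {morph conj_scale^~ v : a b / a + b}.
Proof. by move=> a b; rewrite /conj_scale rmorphD scalerDl. Qed.
HB.instance Definition _ := GRing.Zmodule_isLmodule.Build K (conj_mod V)
  conj_scaleA conj_scale1 conj_scaleDr conj_scaleDl.
End ConjMod.

Section TensorStar.
Variables (K : numClosedFieldType) (A B : starAlgType K).

(* The conjugate-linear map [a ⊗ b |-> star a ⊗ star b]. *)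
Definition tstar (x : tens A B) : tens A B :=
  tlift (fun a b => star a ⊗ star b : conj_mod (tens A B)) x.

Lemma tstar_bilinear :
  bilinear_map (fun a b => star a ⊗ star b : conj_mod (tens A B)).
Proof.
have [h1 h2] := @pure_bilinear K A B.
split=> [b c a a'|a c b b'] /=; rewrite starD starZ.
- exact: h1.
- exact: h2.
Qed.

Lemma tstar_pure a b : tstar (a ⊗ b) = star a ⊗ star b.
Proof. exact: (tlift_pure _ _ tstar_bilinear). Qed.
Lemma tstarD : {morph tstar : x y / x + y}.
Proof. exact: (tlift_add tstar_bilinear). Qed.
Lemma tstarZ (c : K) x : tstar (c *: x) = c^* *: tstar x.
Proof. exact: (tlift_scale tstar_bilinear). Qed.
End TensorStar.

Record hopfStarAlgebra (K : numClosedFieldType) := HopfStarAlgebra {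
  hopf_alg :> starAlgType K;
  coprod : {linear hopf_alg -> tens hopf_alg hopf_alg};
  counit : {scalar hopf_alg};
  antipode : {linear hopf_alg -> hopf_alg};
  coprod_alg : monoid_morphism coprod;
  coprod_star : forall a, coprod (star a) = tstar (coprod a);
  counit_alg : monoid_morphism counit;
  coprodA : forall a,
    tassoc (tmap coprod idfun (coprod a)) = tmap idfun coprod (coprod a);
  counit_l : forall a, tlift (fun b c => counit b *: c) (coprod a) = a;
  counit_r : forall a, tlift (fun b c => counit c *: b) (coprod a) = a;
  antipode_l : forall a,
    tlift (fun b c => antipode b * c) (coprod a) = counit a *: 1;
  antipode_r : forall a,
    tlift (fun b c => b * antipode c) (coprod a) = counit a *: 1
}.

(* As for normed modules over [R[i]], norms take values in the nonnegative
   elements of [R[i]]. *)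
Definition is_cstar_norm (K : numClosedFieldType) (A : lmodType K)
    (mul : A -> A -> A) (st : A -> A) (p : A -> K) : Prop :=
  [/\ forall x, 0 <= p x /\ (p x = 0 -> x = 0),
      forall x y, p (x + y) <= p x + p y,
      forall c x, p (c *: x) = `|c| * p x,
      forall x y, p (mul x y) <= p x * p y &
      forall x, p (mul (st x) x) = p x ^+ 2].

HB.mixin Record isCStarAlgebra (R : realType) A of StarAlgebra R[i] A := {
  cnorm : A -> R[i];
  cnorm_cstar : is_cstar_norm *%R star cnorm;
  cnorm_complete : forall u : nat -> A,
    (forall e, 0 < e -> exists N, forall m n, (N <= m)%N -> (N <= n)%N ->
       cnorm (u m - u n) < e) ->
    exists l, forall e, 0 < e -> exists N, forall n, (N <= n)%N ->
       cnorm (u n - l) < e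
}.

#[short(type="cstarAlgType")]
HB.structure Definition CStarAlgebra (R : realType) :=
  {A of isCStarAlgebra R A & StarAlgebra R[i] A}.

Section CStar.
Variable R : realType.
Local Notation C := R[i].

Definition norm_dense (A : cstarAlgType R) (X : set A) : Prop :=
  forall a (e : C), 0 < e -> exists2 x, X x & cnorm (a - x) < e.

Definition bounded_map (A B : cstarAlgType R) (F : A -> B) : Prop :=
  exists M : C, forall a, cnorm (F a) <= M * cnorm a.

Definition tensor_cstar_norm (A B : cstarAlgType R) (p : tens A B -> C) : Prop :=
  @is_cstar_norm C (tens A B) (fun x y => x * y) (@tstar _ A B) p.

(* [T], with [j a b] in the role of a ⊗ b, is the completion of the algebraic
   tensor product of [A] and [B] in its smallest C*-norm. *)
Definition is_min_tensor (A B T : cstarAlgType R) (j : A -> B -> T) : Prop :=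
  [/\ bilinear_map j,
      forall a a' b b', j (a * a') (b * b') = j a b * j a' b',
      forall a b, j (star a) (star b) = star (j a b),
      tensor_cstar_norm (fun x => cnorm (tlift j x))
        /\ (forall p, tensor_cstar_norm p ->
              forall x, cnorm (tlift j x) <= p x) &
      norm_dense (range (tlift j))].

(* [F] is the bounded linear extension of f ⊗ g, where [j] and [j'] are the
   tensor product maps of its domain and codomain. *)
Definition is_tensor_map (U V : lmodType C) (A B : cstarAlgType R)
    (T W : cstarAlgType R) (j : A -> B -> T) (j' : U -> V -> W)
    (f : A -> U) (g : B -> V) (F : T -> W) : Prop :=
  [/\ linear F, bounded_map F & forall a b, F (j a b) = j' (f a) (g b)].

Record compactQuantumGroup := CompactQuantumGroup {
  cqg_alg :> cstarAlgType R;
  cqg_alg2 : cstarAlgType R;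
  cten : cqg_alg -> cqg_alg -> cqg_alg2;
  cten_min : is_min_tensor cten;
  (* The threefold tensor product, bracketed in the two possible ways. *)
  cqg_alg3 : cstarAlgType R;
  cten21 : cqg_alg2 -> cqg_alg -> cqg_alg3;
  cten12 : cqg_alg -> cqg_alg2 -> cqg_alg3;
  cten21_min : is_min_tensor cten21;
  cten12_min : is_min_tensor cten12;
  ctenA : forall a b c, cten21 (cten a b) c = cten12 a (cten b c);
  comult : {lrmorphism cqg_alg -> cqg_alg2};
  comult_star : forall a, comult (star a) = star (comult a);
  comultA : exists F1 F2,
    [/\ is_tensor_map cten cten21 comult idfun F1,
        is_tensor_map cten cten12 idfun comult F2 &
        forall a, F1 (comult a) = F2 (comult a)];
  comult_dense_l : norm_dense (linear_span
    [set x | exists a b, x = cten a 1 * comult b]);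
  comult_dense_r : norm_dense (linear_span
    [set x | exists a b, x = cten 1 a * comult b])
}.

Definition is_state (A : cstarAlgType R) (phi : A -> C) : Prop :=
  [/\ scalar phi, forall a, 0 <= phi (star a * a) & phi 1 = 1].

(* A state [h] with (h ⊗ id)Δ = (id ⊗ h)Δ = h(.)1. *)
Definition is_haar_state (G : compactQuantumGroup) (h : G -> C) : Prop :=
  [/\ is_state h,
      exists2 F, is_tensor_map (@cten G) (fun (c : C^o) (a : G) => c *: a)
                   h idfun F &
                 forall a, F (comult G a) = h a *: 1 &
      exists2 F, is_tensor_map (@cten G) (fun (a : G) (c : C^o) => c *: a)
                   idfun h F &
                 forall a, F (comult G a) = h a *: 1].

Section Representations.
Variable G : compactQuantumGroup.

Definition adjoint_mx n (u : 'M[G]_n) : 'M[G]_n := \matrix_(i, j) star (u j i).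

Definition unitary_rep n (u : 'M[G]_n) : Prop :=
  [/\ u *m adjoint_mx u = 1%:M, adjoint_mx u *m u = 1%:M &
      forall i j, comult G (u i j) = \sum_k cten (u i k) (u k j)].

(* The range of the idempotent [p] is an invariant subspace of C^n for the
   representation e_j |-> \sum_i e_i ⊗ u_ij. *)
Definition invariant_idempotent n (u : 'M[G]_n) (p : 'M[C]_n) : Prop :=
  let pG := map_mx (in_alg G) p in
  p *m p = p /\ pG *m u *m pG = u *m pG.

Definition irreducible_rep n (u : 'M[G]_n) : Prop :=
  (0 < n)%N /\
  forall p, invariant_idempotent u p -> p = 0 \/ p = 1%:M.

Definition matrix_elements : set G :=
  [set a | exists n (u : 'M[G]_n),
     [/\ unitary_rep u, irreducible_rep u & exists i j, a = u i j]].

(* The span of the matrix elements, presented as an abstract Hopf star-algebra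
   embedded in the C*-algebra of [G]. That the span is a Hopf star-algebra is a
   theorem of Woronowicz; its counit and antipode are unique. *)
Record associatedHopf := AssociatedHopf {
  assoc_hopf :> hopfStarAlgebra C;
  assoc_incl : {lrmorphism assoc_hopf -> G};
  assoc_incl_inj : injective assoc_incl;
  assoc_incl_star : forall a, assoc_incl (star a) = star (assoc_incl a);
  assoc_incl_range : range assoc_incl = linear_span matrix_elements;
  assoc_incl_coprod : forall a,
    tlift (fun b c => cten (assoc_incl b) (assoc_incl c)) (coprod assoc_hopf a)
    = comult G (assoc_incl a)
}.

End Representations.
End CStar.

Record gradedStarAlgebra (K : numClosedFieldType) := GradedStarAlgebra {
  graded_alg :> algType K;
  homog : nat -> set graded_alg;
  homog_direct : is_direct_sum homog setT;
  homogM : forall k l x y, homog k x -> homog l y -> homog (k + l) (x * y);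
  gstar : graded_alg -> graded_alg;
  gstarD : {morph gstar : x y / x + y};
  gstarZ : forall (c : K) x, gstar (c *: x) = c^* *: gstar x;
  gstar_homog : forall k x, homog k x -> homog k (gstar x);
  gstarK : involutive gstar;
  gstarM : forall k l x y, homog k x -> homog l y ->
    gstar (x * y) = (-1) ^+ (k * l) *: (gstar y * gstar x)
}.

Record gradedStarDiffAlgebra (K : numClosedFieldType) := GradedStarDiffAlgebra {
  gsda_alg :> gradedStarAlgebra K;
  diff : {linear gsda_alg -> gsda_alg};
  diff_homog : forall k x, homog k x -> homog k.+1 (diff x);
  diffK : forall x, diff (diff x) = 0;
  diff_star : forall x, diff (gstar x) = gstar (diff x);
  diffM : forall k x y, homog k x ->
    diff (x * y) = diff x * y + (-1) ^+ k *: (x * diff y)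
}.

(* The algebra is unital with the unit of [A]: the span condition, [diff1] and
   the Leibniz rule force the unit of [A] to be a unit. *)
Record starDiffCalculus (K : numClosedFieldType) (A : hopfStarAlgebra K) :=
    StarDiffCalculus {
  calc_alg :> gradedStarDiffAlgebra K;
  base : {lrmorphism A -> calc_alg};
  base_inj : injective base;
  base_star : forall a, base (star a) = gstar (base a);
  base_range : range base = @homog _ calc_alg 0;
  homog_span : forall k, (0 < k)%N ->
    @homog _ calc_alg k = linear_span
      [set x | exists (a0 : A) (a : 'I_k -> A),
         x = base a0 * \prod_(i < k) diff calc_alg (base (a i))];
  coact : {linear calc_alg -> tens A calc_alg};
  coact_alg : monoid_morphism coact;
  coact_base : forall a, coact (base a) = tmap idfun base (coprod A a);
  coact_diff : forall x,
    tmap idfun (diff calc_alg) (coact x) = coact (diff calc_alg x);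
  diff1 : diff calc_alg 1 = 0
}.

Section Calculus.
Variables (K : numClosedFieldType) (A : hopfStarAlgebra K).
Variable Omega : starDiffCalculus A.
Local Notation d := (diff Omega).

Definition left_inv : set Omega := [set w | coact Omega w = 1 ⊗ w].

Definition strongly_finite_dimensional : Prop := finite_dimensional left_inv.

Definition graded_form (ip : Omega -> Omega -> K) : Prop :=
  forall k l x y, k <> l -> homog k x -> homog l y -> ip x y = 0.

Definition left_invariant_form (h : A -> K) (ip : Omega -> Omega -> K) : Prop :=
  forall a b w e, left_inv w -> left_inv e ->
    ip (base Omega a * w) (base Omega b * e) = h (star b * a) * ip w e.

Definition is_adjoint (ip : Omega -> Omega -> K) (f g : Omega -> Omega) : Prop :=
  forall x y, ip (f x) y = ip x (g y).

Definition dirac (dstar : Omega -> Omega) (w : Omega) : Omega := d w + dstar w.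

Definition laplacian (dstar : Omega -> Omega) (w : Omega) : Omega :=
  dirac dstar (dirac dstar w).

End Calculus.

Definition is_orthogonal_sum (K : fieldType) (V : lmodType K)
    (ip : V -> V -> K) (I : eqType) (X : I -> set V) (Y : set V) : Prop :=
  is_direct_sum X Y /\
  forall i j x y, i != j -> X i x -> X j y -> ip x y = 0.

(* Main.v *)
(** Every element of the Hopf algebra is a combination of entries of
    corepresentations [u], and [C = span (u i j)] satisfies [Delta C ⊂ C ⊗ H].
    Invariance of the Haar functional shows that the orthogonal complement of
    [C] also satisfies this inclusion.  For any subspace [C] with
    [Delta C ⊂ C ⊗ H] the differential preserves [C . Omega^inv], since
    [d a = a_1 (S(a_2) d a_3)] with [S(a_2) d a_3] left-invariant.  Applied to
    [C] and to its complement, this makes the finite-dimensional space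
    [C . Omega^inv] stable under both [d] and its adjoint.  These spaces span
    [Omega], so the symmetric operator [D = d + d^*] has eigenvectors spanning
    [Omega], and the Hodge decomposition follows from [D^2 = d d^* + d^* d]. *)

Require Import Defs.
From mathcomp Require Import all_boot all_order all_algebra.
From mathcomp Require Import complex.
From mathcomp Require Import boolp classical_sets reals.
Import Order.TTheory GRing.Theory Num.Theory.
Local Open Scope classical_set_scope.
Local Open Scope ring_scope.

Set Implicit Arguments.
Unset Strict Implicit.
Unset Printing Implicit Defensive.

(** * Spanning sets and eigenvectors *)

Section Span.
Context {K : fieldType} {V : lmodType K}.
Implicit Types (X Y : set V) (T : V -> V).

Lemma subspace_sum Y (I : eqType) (s : seq I) (F : I -> V) :
  subspace Y -> (forall i, i \in s -> Y (F i)) -> Y (\sum_(i <- s) F i).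
Proof.
move=> [Y0 YP]; elim: s => [|i s IH] Ys; first by rewrite big_nil.
rewrite big_cons -[F i]scale1r; apply: YP; first by apply: Ys; rewrite mem_head.
by apply: IH => j js; apply: Ys; rewrite inE js orbT.
Qed.

Lemma subspaceD Y x y : subspace Y -> Y x -> Y y -> Y (x + y).
Proof. by move=> [_ YP] Yx Yy; rewrite -[x]scale1r; apply: YP. Qed.

Lemma subspaceZ Y (c : K) x : subspace Y -> Y x -> Y (c *: x).
Proof. by move=> [Y0 YP] Yx; rewrite -[_ *: _]addr0; apply: YP. Qed.

Lemma subspaceB Y x y : subspace Y -> Y x -> Y y -> Y (x - y).
Proof.
by move=> YV Yx Yy; apply: subspaceD => //; rewrite -scaleN1r; apply: subspaceZ.
Qed.

Lemma subspace_linear_span X : subspace (linear_span X).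
Proof.
split=> [|c x y [s sX ->] [r rX ->]].
  by exists [::]; rewrite ?big_nil.
exists ([seq (c * p.1, p.2) | p <- s] ++ r).
  by move=> p; rewrite mem_cat => /orP[/mapP[q qs ->]|/rX//]; apply: (sX q).
rewrite big_cat big_map scaler_sumr; congr (_ + _).
by apply: eq_bigr => p _; rewrite scalerA.
Qed.

Lemma mem_linear_span X x : X x -> linear_span X x.
Proof.
move=> Xx; exists [:: (1, x)]; last by rewrite big_seq1 scale1r.
by move=> p; rewrite inE => /eqP ->.
Qed.

Lemma linear_span_min X Y : subspace Y -> X `<=` Y -> linear_span X `<=` Y.
Proof.
move=> YV XY _ [s sX ->]; apply: subspace_sum => // p ps.
by apply: subspaceZ => //; apply: XY; apply: sX.
Qed.

Lemma linear_span_mono X Y : X `<=` Y -> linear_span X `<=` linear_span Y.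
Proof.
move=> XY; apply: linear_span_min; first exact: subspace_linear_span.
by move=> x /XY/mem_linear_span.
Qed.

Lemma linear_span_map (W : lmodType K) (T : {linear V -> W}) X (Y : set W) :
  subspace Y -> (forall x, X x -> Y (T x)) ->
  forall x, linear_span X x -> Y (T x).
Proof.
move=> [Y0 YP] XY; apply: (linear_span_min (Y := [set x | Y (T x)])) => //.
by split=> [/=|c x y /= xY yY]; rewrite ?linear0 // linearP; apply: YP.
Qed.

Definition independent (B : set V) : Prop :=
  forall (s : seq V) (c : V -> K), uniq s -> (forall v, v \in s -> B v) ->
     \sum_(v <- s) c v *: v = 0 -> forall v, v \in s -> c v = 0.

Lemma independent_setU1 B x :
  independent B -> ~ linear_span B x -> independent (B `|` [set x]).
Proof.
move=> Bi xB s c us sB sum0.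
have cB : (forall v, v \in s -> v != x -> B v).
  by move=> v /sB[//|->]; rewrite eqxx.
have [xs|xs] := boolP (x \in s); last first.
  by apply: Bi => // v vs; apply: cB => //; apply: contraNneq xs => <-.
move: sum0; rewrite (perm_big _ (perm_to_rem xs)) big_cons /= => sum0.
have us' := rem_uniq x us.
have memr v : v \in rem x s = (v != x) && (v \in s) by rewrite mem_rem_uniq.
(* A nonzero coefficient at [x] would put [x] in the span of [B]. *)
have cx : c x = 0.
  apply: contra_notP xB => /eqP cx.
  have -> : x = - (c x)^-1 *: \sum_(v <- rem x s) c v *: v.
    move/addr0_eq: sum0 => <-.
    by rewrite scaleNr scalerN opprK scalerA mulVf // scale1r.
  apply: subspaceZ; first exact: subspace_linear_span.
  apply: subspace_sum; first exact: subspace_linear_span.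
  move=> v; rewrite memr => /andP[vx vs]; apply: subspaceZ.
    exact: subspace_linear_span.
  by apply: mem_linear_span; apply: cB.
move: sum0; rewrite cx scale0r add0r => sum0 v vs.
have [->//|vx] := eqVneq v x.
apply: (Bi (rem x s)) => //; last by rewrite memr vx.
by move=> w; rewrite memr => /andP[wx ws]; apply: cB.
Qed.

(** Zorn's lemma on the independent subsets of [X]: a maximal one spans every element of [X], since
    an element outside its span could be adjoined. *)
Lemma hamel_basis_sub X :
  linear_span X = setT -> exists2 B, hamel_basis B & B `<=` X.
Proof.
move=> spanX.
have [F FP Ft|B [[BX Bi] Bmax]] :=
    @Zorn_bigcup V (fun B => B `<=` X /\ independent B).
  split=> [x [B /FP[BX _] /BX //]|s c us sF].
  have [->|s0] := eqVneq s [::]; first by [].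
  (* Finitely many vectors of the union of a chain already lie in one member of it. *)
  have [B FB sB] : exists2 B, F B & forall v, v \in s -> B v.
    elim: s s0 sF {us} => // v s IH _ sF.
    have [B1 FB1 B1v] := sF v (mem_head _ _).
    have [s0|s0] := eqVneq s [::].
      by exists B1 => // w; rewrite s0 inE => /eqP ->.
    have [|B2 FB2 B2s] := IH s0.
      by move=> w ws; apply: sF; rewrite inE ws orbT.
    have [B12|B21] := Ft _ _ FB1 FB2.
      by exists B2 => // w; rewrite inE => /orP[/eqP ->|/B2s//]; apply: B12.
    by exists B1 => // w; rewrite inE => /orP[/eqP -> //|/B2s]; apply: B21.
  by have [_ Bi] := FP _ FB; apply: Bi.
exists B => //; split=> //; apply/seteqP; split=> // x _.
have : linear_span X x by rewrite spanX.
apply: (linear_span_min (@subspace_linear_span B)) => {}x Xx.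
apply: contrapT => xB; apply: (Bmax (B `|` [set x])).
  split; first by left.
  by move=> /(_ x) Bx; apply: xB; apply/mem_linear_span/Bx; right.
split; last exact: independent_setU1.
by move=> y [/BX//|->].
Qed.

(** Zero summands and repeated eigenvalues are allowed, so that closure under sums is mere
    concatenation of lists. *)
Definition eigensum T : set V := [set x | exists2 s : seq (K * V),
  (forall p, p \in s -> T p.2 = p.1 *: p.2) & x = \sum_(p <- s) p.2].

Lemma eigen_eigensum T t v : T v = t *: v -> eigensum T v.
Proof.
move=> Tv; exists [:: (t, v)]; last by rewrite big_seq1.
by move=> p; rewrite inE => /eqP ->.
Qed.

Lemma eigensumD T x y : eigensum T x -> eigensum T y -> eigensum T (x + y).
Proof.
move=> [s sT ->] [r rT ->]; exists (s ++ r); last by rewrite big_cat.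
by move=> p; rewrite mem_cat => /orP[/sT|/rT].
Qed.

Lemma subspace_eigensum (T : {linear V -> V}) : subspace (eigensum T).
Proof.
split=> [|c x y [s sT ->] Ty]; first by exists [::]; rewrite ?big_nil.
apply: eigensumD => //; exists [seq (p.1, c *: p.2) | p <- s].
  by move=> p /mapP[q qs ->]; rewrite /= linearZ /= sT // !scalerA mulrC.
by rewrite big_map scaler_sumr.
Qed.

(** The eigenvectors span, and a Hamel basis is extracted from them; zero summands are set aside, as
    they are not eigenvectors. *)
Lemma diagonalisable_eigensum T :
  (forall x, eigensum T x) -> diagonalisable T.
Proof.
move=> Teig.
have [|B Bb BT] := @hamel_basis_sub [set v | exists t, eigenvector T t v].
  apply/seteqP; split=> // x _; have [s sT ->] := Teig x.
  apply: subspace_sum => [|p ps]; first exact: subspace_linear_span.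
  have [->|p0] := eqVneq p.2 0; first by have [] := @subspace_linear_span
    [set v | exists t, eigenvector T t v].
  by apply: mem_linear_span; exists p.1; split=> //; apply: sT.
by exists B => // v /BT.
Qed.

(** * Polynomials in an operator *)

Section PolyAction.
Variable T : {linear V -> V}.

(** The vector p(T)x, written with iterates since [V] may be infinite-dimensional and [T] then has
    no matrix. *)
Definition poly_act (p : {poly K}) (x : V) : V :=
  \sum_(i < size p) p`_i *: iter i T x.

Lemma poly_act_widen (p : {poly K}) n x :
  (size p <= n)%N -> poly_act p x = \sum_(i < n) p`_i *: iter i T x.
Proof.
move=> pn; rewrite /poly_act (big_ord_widen n (fun i => p`_i *: iter i T x)) //.
rewrite [RHS](bigID (fun i : 'I_n => (i < size p)%N)) /=.
rewrite [X in _ = _ + X]big1 ?addr0 //.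
by move=> i; rewrite -leqNgt => ip; rewrite nth_default // scale0r.
Qed.

Lemma poly_actZ c p x : poly_act (c *: p) x = c *: poly_act p x.
Proof.
rewrite (@poly_act_widen _ (size p)) ?size_scale_leq // scaler_sumr.
by apply: eq_bigr => i _; rewrite coefZ scalerA.
Qed.

(** The factor X - t acts first, so the roots of an annihilating polynomial can be peeled off at the
    vector. *)
Lemma poly_act_mulXsubC t p x :
  poly_act (p * ('X - t%:P)) x = poly_act p (T x - t *: x).
Proof.
have sz : (size (p * ('X - t%:P))%R <= (size p).+1)%N.
  by rewrite (leq_trans (size_polyMleq _ _)) // size_XsubC addn2.
have iterB i : iter i T (T x - t *: x) = iter i.+1 T x - t *: iter i T x.
  by elim: i => //= i ->; rewrite linearB linearZ.
rewrite (poly_act_widen x sz).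
under eq_bigr do rewrite mulrBr coefB coefMX coefMC scalerBl.
(* The two sums are aligned by dropping end terms: the constant coefficient of p X and the
   coefficient of [p] at index [size p] both vanish. *)
rewrite sumrB big_ord_recl /= scale0r add0r [X in _ - X]big_ord_recr /=.
rewrite [p`_(size p)]nth_default // mul0r scale0r addr0 -sumrB.
apply: eq_bigr => i _; rewrite iterB scalerBr scalerA.
by [].
Qed.

(** The n + 1 vectors x, T x, ..., T^n x lie in the span of n vectors, hence satisfy a linear
    relation; its coefficients are those of [p]. *)
Lemma poly_act_kill (s : seq V) x :
  (forall n, linear_span [set` s] (iter n T x)) ->
  exists2 p : {poly K}, p != 0 & poly_act p x = 0.
Proof.
move=> xs; pose n := size s.
have coords y : linear_span [set` s] y ->
    exists c : 'rV[K]_n, y = \sum_(i < n) c 0 i *: s`_i.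
  move=> [r rs ->]; elim: r rs => [|p r IH] rs.
    by exists 0; rewrite big_nil big1 // => i _; rewrite mxE scale0r.
  have [|c IHc] := IH; first by move=> q qr; apply: rs; rewrite inE qr orbT.
  have ps : p.2 \in s by apply: (rs p); rewrite mem_head.
  have ip : (index p.2 s < n)%N by rewrite index_mem.
  exists (p.1 *: delta_mx 0 (Ordinal ip) + c).
  under [RHS]eq_bigr do rewrite !mxE scalerDl.
  rewrite big_split big_cons IHc /=; congr (_ + _).
  rewrite (bigD1 (Ordinal ip)) //= !eqxx mulr1 nth_index // big1 ?addr0 //.
  by move=> i /negPf ->; rewrite mulr0 scale0r.
have [c cP] := choice (fun k => coords _ (xs k)).
pose M := \matrix_(k < n.+1, i < n) c k 0 i.
(* [M] has one more row than columns. *)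
have kM : kermx M != 0.
  rewrite -mxrank_eq0 -lt0n mxrank_ker subn_gt0 (leq_ltn_trans (rank_leq_col _)) //.
have [v vM v0] : exists2 v : 'rV_n.+1, v *m M = 0 & v != 0.
  have [v vk v0] := rowV0Pn kM.
  by exists v => //; apply/sub_kermxP.
exists (rVpoly v).
  by apply: contra v0 => /eqP rv; rewrite -[v]rVpolyK rv linear0.
rewrite (@poly_act_widen _ n.+1) ?size_poly //.
under eq_bigr do rewrite coef_rVpoly_ord cP scaler_sumr.
rewrite exchange_big big1 //= => i _.
under eq_bigr do rewrite scalerA.
rewrite -scaler_suml; move/rowP/(_ i): vM; rewrite !mxE.
by under eq_bigr do rewrite mxE; move=> ->; rewrite scale0r.
Qed.

End PolyAction.
End Span.

(** * Inner products, orthonormal frames and symmetric operators *)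

Section InnerProduct.
Context {K : numClosedFieldType} {V : lmodType K}.

(** Stated for plain functions, so that it serves both for the form on the calculus and for the Haar
    form on the Hopf algebra. *)
Definition inner_product (q : V -> V -> K) : Prop :=
  [/\ forall y, scalar (q^~ y), forall x y, q x y = (q y x)^* &
      forall x, x != 0 -> 0 < q x x].

Variables (q : V -> V -> K) (qP : inner_product q).

Lemma ip_linear y : scalar (q^~ y). Proof. by case: qP. Qed.
Lemma ipC x y : q x y = (q y x)^*. Proof. by case: qP. Qed.
Lemma ip_eq0 x : q x x = 0 -> x = 0.
Proof.
move=> qx; apply/eqP; apply: contraT => x0; case: qP => _ _ /(_ _ x0).
by rewrite qx ltxx.
Qed.
Lemma ipDl x y z : q (x + y) z = q x z + q y z.
Proof. by have := ip_linear z 1 x y; rewrite scale1r mul1r. Qed.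
Lemma ip0l z : q 0 z = 0.
Proof. by apply: (addIr (q 0 z)); rewrite -ipDl !add0r. Qed.
Lemma ipZl c x z : q (c *: x) z = c * q x z.
Proof. by have := ip_linear z c x 0; rewrite !addr0 ip0l addr0. Qed.
Lemma ipBl x y z : q (x - y) z = q x z - q y z.
Proof. by rewrite ipDl -scaleN1r ipZl mulN1r. Qed.
Lemma ip0r z : q z 0 = 0. Proof. by rewrite ipC ip0l rmorph0. Qed.
Lemma ipDr x y z : q z (x + y) = q z x + q z y.
Proof. by rewrite ipC ipDl rmorphD /= -!ipC. Qed.
Lemma ipZr c x z : q z (c *: x) = c^* * q z x.
Proof. by rewrite ipC ipZl rmorphM /= -ipC. Qed.
Lemma ip_suml (I : Type) (s : seq I) F z :
  q (\sum_(i <- s) F i) z = \sum_(i <- s) q (F i) z.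
Proof. exact: (big_morph (q^~ z) (fun x y => ipDl x y z) (ip0l z)). Qed.
Lemma ip_sumr (I : Type) (s : seq I) F z :
  q z (\sum_(i <- s) F i) = \sum_(i <- s) q z (F i).
Proof. exact: (big_morph (q z) (fun x y => ipDr x y z) (ip0r z)). Qed.

Lemma ip_nondeg x : (forall y, q x y = 0) -> x = 0.
Proof. by move=> /(_ x)/ip_eq0. Qed.

Lemma subspace_orth (X : set V) : subspace [set x | forall y, X y -> q x y = 0].
Proof.
split=> [y _|c x x' xX x'X y Xy]; first exact: ip0l.
by rewrite ipDl ipZl xX // x'X // mulr0 addr0.
Qed.

(** Gram-Schmidt. The list [e] is an orthonormal basis of the span, recorded only through the
    expansion formula. *)
Lemma orthogonal_frame (s : seq V) : exists2 e : seq V,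
  (forall v, v \in e -> linear_span [set` s] v) &
  forall y, linear_span [set` s] y -> y = \sum_(v <- e) q y v *: v.
Proof.
have proj_span X e : (forall y, X y -> y = \sum_(v <- e) q y v *: v) ->
    forall y, linear_span X y -> y = \sum_(v <- e) q y v *: v.
  move=> Xe; apply: (@linear_span_min _ _ X
     [set y | y = \sum_(v <- e) q y v *: v]) => //.
  split=> [/=|c x y /= xe ye]; first by rewrite big1 // => v _; rewrite ip0l scale0r.
  rewrite {1}xe {1}ye scaler_sumr -big_split /=.
  by apply: eq_bigr => v _; rewrite ipDl ipZl scalerDl scalerA.
elim: s => [|y s [e es se]].
  exists [::] => //; apply: proj_span => y //.
have sub : linear_span [set` s] `<=` linear_span [set` y :: s].
  by apply: linear_span_mono => v /= vs; rewrite inE vs orbT.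
pose r := y - \sum_(v <- e) q y v *: v.
have ry : linear_span [set` y :: s] r.
  apply: subspaceB; first exact: subspace_linear_span.
    by apply: mem_linear_span; rewrite /= mem_head.
  apply: subspace_sum; first exact: subspace_linear_span.
  by move=> v /es/sub vy; apply: subspaceZ => //; exact: subspace_linear_span.
(* The residual [r] of [y] is orthogonal to the previous span. *)
have r_orth z : linear_span [set` s] z -> q r z = 0.
  move=> zs; rewrite ipBl ip_suml [X in q y X]se // ip_sumr -sumrB big1 // => v _.
  by rewrite ipZl ipZr -ipC mulrC subrr.
have [r0|r0] := eqVneq r 0.
  exists e => [v /es/sub //|]; apply: proj_span => z /=.
  rewrite inE => /orP[/eqP ->|zs]; last by apply: se; apply: mem_linear_span.
  by apply/eqP; rewrite -subr_eq0 -/r r0.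
have rr : 0 < q r r by case: qP => _ _; apply.
(* [c] is the norm of the residual; it is real, so conjugation in the second variable leaves it
   alone. *)
pose c := sqrtC (q r r); have cc : c * c = q r r by rewrite -expr2 sqrtCK.
have c0 : c != 0 by rewrite sqrtC_eq0 gt_eqF.
have cr : c^* = c by apply: geC0_conj; rewrite sqrtC_ge0 ltW.
exists (c^-1 *: r :: e).
  move=> v; rewrite inE => /orP[/eqP ->|/es/sub //].
  by apply: subspaceZ => //; exact: subspace_linear_span.
apply: proj_span => z /=; rewrite big_cons inE => /orP[/eqP ->|zs]; last first.
  have zs' := @mem_linear_span _ _ [set` s] z zs.
  by rewrite ipZr (ipC z) r_orth // rmorph0 mulr0 scale0r add0r -se.
(* [y - r] lies in the span of [s], to which [r] is orthogonal. *)
have qyr : q y r = q r r.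
  rewrite -{1}[y](subrK (\sum_(v <- e) q y v *: v)) -/r ipDl ip_suml.
  rewrite [X in _ + X]big_seq [X in _ + X]big1 ?addr0 // => v /es ve.
  by rewrite ipZl (ipC v) r_orth // rmorph0 mulr0.
rewrite ipZr qyr fmorphV /= cr -cc mulKf // scalerA mulfV // scale1r.
by rewrite subrK.
Qed.

(** For arbitrary [x] the frame sum is the orthogonal projection of [x] onto [X]. *)
Lemma orthogonal_projection (X : set V) : finite_dimensional X ->
  exists2 e : seq V, (forall v, v \in e -> X v) &
    forall x y, X y -> q (x - \sum_(v <- e) q x v *: v) y = 0.
Proof.
move=> [s ->]; have [e es se] := orthogonal_frame s.
exists e => // x y /se ye.
rewrite ipBl ip_suml [X in q x X]ye ip_sumr -sumrB big1 // => v _.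
by rewrite ipZl ipZr -ipC mulrC subrr.
Qed.

Section Symmetric.
Variables (T : {linear V -> V}) (Tsym : forall x y, q (T x) y = q x (T y)).

Lemma eigensum_step z x : eigensum T (T x - z *: x) -> eigensum T x.
Proof.
move=> [s sT sE].
(* The eigenvalues occurring in [s] are removed one at a time; [w] collects the
   part with eigenvalue [z], and vanishes because [q w w = q (T x - z x) w = 0]. *)
suff H w : T w = z *: w -> T x - z *: x = w + \sum_(p <- s) p.2 -> eigensum T x.
  by apply: (H 0); rewrite ?linear0 ?scaler0 ?add0r.
elim: s sT x w {sE} => [_ x w Tw|p s IH sT x w Tw].
  rewrite big_nil addr0 => Tx.
  suff w0 : w = 0 by apply: (@eigen_eigensum _ _ _ z); apply/eqP;
    rewrite -subr_eq0 Tx w0.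
  have [//|w0] := eqVneq w 0.
  have zr : z^* = z.
    have ww : q w w != 0 by apply: contraNneq w0 => /ip_eq0 ->.
    by apply: (mulIf ww); rewrite -ipZr -Tw -Tsym Tw ipZl.
  by apply: ip_eq0; rewrite -{1}Tx ipBl Tsym Tw ipZr zr ipZl subrr.
rewrite big_cons => Tx.
have Tp : T p.2 = p.1 *: p.2 by apply: sT; rewrite mem_head.
have {}IH := IH (fun r rs => sT r (mem_behead (s := p :: s) rs)).
have [pz|pz] := eqVneq p.1 z.
  by apply: (IH x (w + p.2)); rewrite -?addrA // linearD scalerDr Tw Tp pz.
have pz0 : p.1 - z != 0 by rewrite subr_eq0.
(* [T - z] sends [(p.1 - z)^-1 *: p.2] to [p.2]; subtracting this vector from [x] removes [p.2] from
   the sum. *)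
rewrite -(subrK ((p.1 - z)^-1 *: p.2) x); apply: eigensumD; last first.
  by apply: (@eigen_eigensum _ _ _ p.1); rewrite linearZ /= Tp !scalerA mulrC.
apply: (IH _ w) => //.
have sub4 (a b c d : V) : a - b - (c - d) = a - c - (b - d).
  by rewrite !opprB addrACA [RHS]addrACA [- c - b]addrC.
rewrite linearB linearZ /= Tp scalerBr [z *: (_ *: _)]scalerA (mulrC z) sub4.
rewrite -[(_ * z) *: _]scalerA -scalerBr -scalerBl scalerA mulVf //.
by rewrite scale1r Tx addrA addrAC addrK.
Qed.

(** An annihilating polynomial of [x] splits over the algebraically closed field; its linear factors
    are removed one by one, symmetry of [T] excluding generalised eigenvectors. *)
Lemma symmetric_eigensum (s : seq V) x :
  (forall n, linear_span [set` s] (iter n T x)) -> eigensum T x.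
Proof.
move=> /(@poly_act_kill _ _ T)[p p0].
have [r pE] := closed_field_poly_normal p.
rewrite pE poly_actZ => /eqP; rewrite scaler_eq0 lead_coef_eq0 (negPf p0) /=.
move=> /eqP {p0 pE}; elim: r x => [|z r IH] x.
  rewrite big_nil /poly_act size_poly1 big_ord1 coef1 scale1r /= => ->.
  by have [] := subspace_eigensum T.
rewrite big_cons mulrC poly_act_mulXsubC => /IH.
exact: eigensum_step.
Qed.

End Symmetric.
End InnerProduct.

(** * Tensor products and corepresentations *)

Section TensorSums.
Context {K : comNzRingType}.

Lemma bilinear_pure (U V U' V' : lmodType K) (f : U -> U') (g : V -> V') :
  linear f -> linear g -> bilinear_map (fun u v => f u ⊗ g v).
Proof.
move=> lf lg; have [h1 h2] := @pure_bilinear K U' V'.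
by split=> [v c x y|u c x y]; rewrite ?lf ?lg; [apply: h1 | apply: h2].
Qed.

Lemma bilinear_mul (U V : lmodType K) (B : algType K) (f : U -> B) (g : V -> B) :
  linear f -> linear g -> bilinear_map (fun u v => f u * g v).
Proof.
move=> lf lg; split=> [v c x y|u c x y]; rewrite ?lf ?lg.
  by rewrite mulrDl scalerAl.
by rewrite mulrDr scalerAr.
Qed.

Lemma bilinear_scale (U V : lmodType K) (f : U -> K) :
  scalar f -> bilinear_map (fun u (v : V) => f u *: v).
Proof.
move=> lf; split=> [v c x y|u c x y]; first by rewrite lf scalerDl scalerA.
by rewrite scalerDr !scalerA mulrC.
Qed.

Lemma tlift_sum (U V W : lmodType K) (b : U -> V -> W) (I : Type) (s : seq I)
    (F : I -> tens U V) :
  bilinear_map b -> tlift b (\sum_(i <- s) F i) = \sum_(i <- s) tlift b (F i).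
Proof.
move=> bb; apply: (big_morph (tlift b)); first exact: tlift_add.
exact: tlift_zero.
Qed.

Lemma tlift_sum_pure (U V W : lmodType K) (b : U -> V -> W) (I : Type)
    (s : seq I) (F : I -> U) (E : I -> V) :
  bilinear_map b ->
  tlift b (\sum_(i <- s) F i ⊗ E i) = \sum_(i <- s) b (F i) (E i).
Proof.
by move=> bb; rewrite tlift_sum //; apply: eq_bigr => i _; rewrite tlift_pure.
Qed.

Lemma pure_suml (U V : lmodType K) (I : Type) (s : seq I) (F : I -> U) (v : V) :
  (\sum_(i <- s) F i) ⊗ v = \sum_(i <- s) F i ⊗ v.
Proof.
have bb := @pure_bilinear K U V.
apply: (big_morph (fun u => u ⊗ v)); last exact: (bilin0l bb).
by move=> x y; apply: (bilinDl bb).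
Qed.

Lemma pure_sumr (U V : lmodType K) (I : Type) (s : seq I) (F : I -> V) (u : U) :
  u ⊗ (\sum_(i <- s) F i) = \sum_(i <- s) u ⊗ F i.
Proof.
have bb := @pure_bilinear K U V.
apply: (big_morph (fun v => u ⊗ v)); last exact: (bilin0r bb).
by move=> x y; apply: (bilinDr bb).
Qed.

Lemma mul_sum_pure (A B : algType K) (I J : Type) (s : seq I) (t : seq J)
    (a : I -> A) (b : I -> B) (c : J -> A) (d : J -> B) :
  (\sum_(i <- s) a i ⊗ b i) * (\sum_(j <- t) c j ⊗ d j) =
  \sum_(i <- s) \sum_(j <- t) (a i * c j) ⊗ (b i * d j).
Proof.
rewrite mulr_suml; apply: eq_bigr => i _; rewrite mulr_sumr.
by apply: eq_bigr => j _; apply: tmul_pure.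
Qed.

Lemma tmap_comp (U V V' V'' : lmodType K) (f : V -> V') (g : V' -> V'')
    (x : tens U V) : linear f -> linear g ->
  tmap idfun g (tmap idfun f x) = tmap idfun (g \o f) x.
Proof.
move=> lf lg; rewrite [x]tens_sum.
have lid : linear (@idfun U) by [].
have lgf : linear (g \o f) by move=> c u v /=; rewrite lf lg.
rewrite /tmap (tlift_sum_pure _ _ _ (bilinear_pure lid lf)).
by rewrite !tlift_sum_pure //; [apply: (bilinear_pure lid lgf) |
  apply: (bilinear_pure lid lg)].
Qed.

End TensorSums.

(** * Unitary corepresentations and right coideals *)

Section Corepresentations.
Context {K : numClosedFieldType} {H : hopfStarAlgebra K}.

(** A unitary corepresentation, entry by entry: the first two clauses are u u^* = 1 and u^* u =
    1. *)
Definition corep n (u : 'I_n -> 'I_n -> H) : Prop :=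
  [/\ forall i j, \sum_k u i k * star (u j k) = (i == j)%:R,
      forall i j, \sum_k star (u k i) * u k j = (i == j)%:R &
      forall i j, coprod H (u i j) = \sum_k u i k ⊗ u k j].

Lemma tstar_sum_pure n (A B : starAlgType K) (a : 'I_n -> A) (b : 'I_n -> B) :
  tstar (\sum_k a k ⊗ b k) = \sum_k star (a k) ⊗ star (b k).
Proof.
rewrite (big_morph _ (@tstarD K A B) (_ : tstar 0 = 0)).
  by apply: eq_bigr => k _; rewrite tstar_pure.
by apply: (addIr (tstar (0 : tens A B))); rewrite -tstarD !add0r.
Qed.

Section OneCorep.
Context {n : nat} {u : 'I_n -> 'I_n -> H} (uP : corep u).

Lemma sum_delta (B : algType K) (F : 'I_n -> B) i :
  \sum_k (i == k)%:R * F k = F i.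
Proof.
rewrite (bigD1 i) //= eqxx mul1r big1 ?addr0 // => k /negPf.
by rewrite eq_sym => ->; rewrite mul0r.
Qed.

(** The counit axiom reads u = u eps(u) in matrix form; multiplication by u^* on the left gives
    eps(u) = 1. *)
Lemma counit_corep i j : counit H (u i j) *: 1 = (i == j)%:R :> H.
Proof.
have [_ u2 uD] := uP; rewrite -u2.
have cu k : u k j = \sum_l counit H (u l j) *: u k l.
  rewrite -{1}[u k j]counit_r uD tlift_sum_pure //.
  split=> [v c x y|x c y z].
    by rewrite scalerDr !scalerA mulrC.
  by rewrite linearP /= scalerDl scalerA.
under [RHS]eq_bigr => k _ do rewrite cu mulr_sumr.
rewrite exchange_big /=.
under [RHS]eq_bigr => l _.
  under eq_bigr do rewrite -scalerAr.
  rewrite -scaler_sumr u2 -[(i == l)%:R]mulr1 scalerAr.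
  over.
by rewrite sum_delta.
Qed.

(** By the antipode axiom S(u) is a left inverse of u, and u^* is a right inverse, so the two
    agree. *)
Lemma antipode_corep i j : antipode H (u i j) = star (u j i).
Proof.
have [u1 u2 uD] := uP.
have Su l : \sum_k antipode H (u i k) * u k l = (i == l)%:R.
  rewrite -counit_corep -antipode_l uD tlift_sum_pure //.
  by apply: (@bilinear_mul _ _ _ _ (antipode H) idfun) => // c x y; rewrite linearP.
rewrite -[RHS](sum_delta (fun l => star (u j l)) i).
under [RHS]eq_bigr do rewrite -Su mulr_suml.
rewrite exchange_big /=.
under [RHS]eq_bigr => k _.
  under eq_bigr do rewrite -mulrA.
  rewrite -mulr_sumr u1 eq_sym.
  over.
rewrite (bigD1 j) //= eqxx mulr1 big1 ?addr0 // => k /negPf kj.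
by rewrite eq_sym kj mulr0.
Qed.

End OneCorep.

Definition corep_entries : set H :=
  [set a | exists n (u : 'I_n -> 'I_n -> H), corep u /\ exists i j, a = u i j].

(** The inclusion of Delta C in C ⊗ H is expressed by a finite sum with left legs in [C], without
    forming C ⊗ H as a subspace. *)
Definition right_coideal (C : set H) : Prop := subspace C /\
  forall a, C a -> exists2 s : seq (H * H),
    (forall p, p \in s -> C p.1) & coprod H a = \sum_(p <- s) p.1 ⊗ p.2.

Lemma right_coidealT : right_coideal setT.
Proof. by split=> // a _; exists (repr (coprod H a)) => //; apply: tens_sum. Qed.

Lemma right_coideal_span (X : set H) :
  (forall a, X a -> exists2 s : seq (H * H),
    (forall p, p \in s -> linear_span X p.1) &
    coprod H a = \sum_(p <- s) p.1 ⊗ p.2) ->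
  right_coideal (linear_span X).
Proof.
move=> XP; split=> [|a]; first exact: subspace_linear_span.
apply: (linear_span_min (Y := [set a | exists2 s : seq (H * H),
    (forall p, p \in s -> linear_span X p.1) &
    coprod H a = \sum_(p <- s) p.1 ⊗ p.2])) => //.
split=> [|c x y [s sX sE] [t tX tE]].
  by exists [::]; rewrite ?linear0 ?big_nil.
exists ([seq (c *: p.1, p.2) | p <- s] ++ t).
  move=> p; rewrite mem_cat => /orP[/mapP[r rs ->]|/tX //].
  by apply: subspaceZ; [apply: subspace_linear_span | apply: sX].
rewrite linearP /= sE tE big_cat big_map scaler_sumr; congr (_ + _).
by apply: eq_bigr => p _; rewrite (bilinZl (@pure_bilinear K H H)).
Qed.

Lemma entries_finite n (u : 'I_n -> 'I_n -> H) :
  finite_dimensional (linear_span [set a | exists i j, a = u i j]).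
Proof.
exists [seq u i j | i <- index_enum 'I_n, j <- index_enum 'I_n].
congr linear_span; apply/seteqP.
split=> [_ [i [j ->]]|b /allpairsP[[i j] [_ _ ->]]]; last by exists i, j.
by apply: allpairs_f; rewrite mem_index_enum.
Qed.

Lemma right_coideal_corep n (u : 'I_n -> 'I_n -> H) : corep u ->
  right_coideal (linear_span [set a | exists i j, a = u i j]).
Proof.
move=> [_ _ uD]; apply: right_coideal_span => _ [i [j ->]].
exists [seq (u i k, u k j) | k <- index_enum 'I_n].
  by move=> p /mapP[k _ ->] /=; apply: mem_linear_span; exists i, k.
by rewrite big_map uD.
Qed.

End Corepresentations.

(** * Left-invariant forms and their coefficients *)

Section Calculus.
Context {K : numClosedFieldType} {H : hopfStarAlgebra K}.
Context {Omega : starDiffCalculus H}.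
Hypothesis corep_span : forall a : H, linear_span corep_entries a.
Local Notation base := (base Omega).
Local Notation coact := (coact Omega).
Local Notation left_inv := (@left_inv K H Omega).
Local Notation d := (diff Omega).

Lemma subspace_left_inv : subspace left_inv.
Proof.
have bb := @pure_bilinear K H Omega.
split=> [|c x y /= xP yP]; rewrite /left_inv /=.
  by rewrite linear0 (bilin0r bb).
by rewrite linearP /= xP yP (bilinDr bb) (bilinZr bb).
Qed.

Lemma left_inv1 : left_inv 1.
Proof. by have [h _] := coact_alg Omega; rewrite /left_inv /= h. Qed.

Lemma left_invM x y : left_inv x -> left_inv y -> left_inv (x * y).
Proof.
rewrite /left_inv /= => xP yP; have [_ h] := coact_alg Omega.
by rewrite h xP yP; rewrite -[LHS]/(tmul _ _) tmul_pure mul1r.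
Qed.

Lemma left_inv_diff x : left_inv x -> left_inv (d x).
Proof.
rewrite /left_inv /= => xP; rewrite -coact_diff xP /tmap tlift_pure //.
by apply: (@bilinear_pure _ _ _ _ _ idfun) => // c y z; rewrite linearP.
Qed.

Section Covariant.
Variables (l : {linear H -> Omega}).
Hypothesis lcov : forall a, coact (l a) = tmap idfun l (coprod H a).

(* In Sweedler notation [S(a_1) l(a_2)], so that [l(a) = a_1 (cov_coeff a_2)]. *)
Definition cov_coeff (a : H) : Omega :=
  tlift (fun b c => base (antipode H b) * l c) (coprod H a).

Lemma cov_coeff_bilinear :
  bilinear_map (fun b c => base (antipode H b) * l c).
Proof.
by apply: (@bilinear_mul _ _ _ _ (fun b => base (antipode H b)) l) => c x y;
  rewrite !linearP.
Qed.

Lemma cov_coeff_linear : linear cov_coeff.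
Proof.
move=> c x y; rewrite /cov_coeff linearP /=.
by rewrite (tlift_linear cov_coeff_bilinear).
Qed.

Lemma cov_coeff_corep n (u : 'I_n -> 'I_n -> H) (uP : corep u) i j :
  cov_coeff (u i j) = \sum_k base (star (u k i)) * l (u k j).
Proof.
have [_ _ uD] := uP.
rewrite /cov_coeff uD (tlift_sum_pure _ _ _ cov_coeff_bilinear).
by under eq_bigr do rewrite (antipode_corep uP).
Qed.

(** On entries of a corepresentation, the left legs of the coaction add up to the entries of u^* u =
    1. *)
Lemma cov_coeff_left_inv a : left_inv (cov_coeff a).
Proof.
apply: (linear_span_min (X := corep_entries)
  (Y := [set a | left_inv (cov_coeff a)])) => //.
  have [L0 LP] := subspace_left_inv.
  split=> [/=|c x y /= xP yP]; last by rewrite cov_coeff_linear; apply: LP.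
  rewrite -[0](scaler0 _ 0) -[0 *: 0]addr0 cov_coeff_linear scale0r add0r.
  rewrite /cov_coeff linear0 (tlift_zero cov_coeff_bilinear) //.
move=> _ [n [u [uP [i [j ->]]]]] /=; rewrite (cov_coeff_corep uP).
have [_ u2 uD] := uP; have [_ coactM] := coact_alg Omega.
rewrite /left_inv /= linear_sum /=.
have b1 : bilinear_map (fun a b : H => a ⊗ base b).
  by apply: (@bilinear_pure _ _ _ _ _ idfun) => // c x y; rewrite linearP.
have b2 : bilinear_map (fun a b : H => a ⊗ l b).
  by apply: (@bilinear_pure _ _ _ _ _ idfun) => // c x y; rewrite linearP.
under eq_bigr => k _.
  rewrite coactM coact_base coprod_star uD tstar_sum_pure lcov uD.
  rewrite /tmap (tlift_sum_pure _ _ _ b1) (tlift_sum_pure _ _ _ b2).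
  rewrite mul_sum_pure.
  over.
rewrite exchange_big pure_sumr; apply: eq_bigr => k _ /=.
rewrite exchange_big /=.
under eq_bigr do rewrite -pure_suml u2.
rewrite (bigD1 k) //= eqxx big1 ?addr0 // => m /negPf km.
by rewrite eq_sym km (bilin0l (@pure_bilinear K H Omega)).
Qed.

(** In Sweedler notation a_1 S(a_2) l(a_3) = l(a); on entries this is u u^* = 1. *)
Lemma cov_coeffE a : l a = tlift (fun b c => base b * cov_coeff c) (coprod H a).
Proof.
have bb : bilinear_map (fun b c => base b * cov_coeff c).
  apply: (@bilinear_mul _ _ _ _ base cov_coeff); last exact: cov_coeff_linear.
  by move=> c x y; rewrite linearP.
apply: (linear_span_min (X := corep_entries) (Y := [set a | l a =
   tlift (fun b c => base b * cov_coeff c) (coprod H a)])) => //.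
  split=> [/=|c x y /= xP yP]; first by rewrite !linear0 (tlift_zero bb).
  by rewrite !linearP /= (tlift_linear bb) xP yP.
move=> _ [n [u [uP [i [j ->]]]]] /=.
have [u1 _ uD] := uP; rewrite uD (tlift_sum_pure _ _ _ bb).
under eq_bigr => k _ do rewrite (cov_coeff_corep uP) mulr_sumr.
rewrite exchange_big /=.
under eq_bigr => k _.
  under eq_bigr do rewrite mulrA -rmorphM.
  rewrite -mulr_suml -rmorph_sum u1 rmorph_nat.
  over.
by rewrite (sum_delta (fun k => l (u k j))).
Qed.

End Covariant.

(** This is C . Omega^inv. *)
Definition left_span (C : set H) : set Omega :=
  linear_span [set x | exists a w, [/\ C a, left_inv w & x = base a * w]].

Lemma subspace_left_span C : subspace (left_span C).
Proof. exact: subspace_linear_span. Qed.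

Lemma left_spanM C a w : C a -> left_inv w -> left_span C (base a * w).
Proof. by move=> Ca wP; apply: mem_linear_span; exists a, w. Qed.

(* With [l = d] this gives stability under [d]; with [l a = w a], [w]
   left-invariant, it moves coefficients to the left of invariant forms. *)
Lemma left_span_covariant (l : {linear H -> Omega}) C a :
  (forall a, coact (l a) = tmap idfun l (coprod H a)) ->
  right_coideal C -> C a -> left_span C (l a).
Proof.
move=> lcov [CV CP] /CP[s sC sE]; rewrite (cov_coeffE l) sE tlift_sum_pure.
  apply: subspace_sum => [|p ps]; first exact: subspace_left_span.
  by apply: left_spanM; [apply: sC | apply: cov_coeff_left_inv].
apply: (@bilinear_mul _ _ _ _ base (cov_coeff l)); last exact: cov_coeff_linear.
by move=> c x y; rewrite linearP.
Qed.

Lemma left_span_mulr C x w : left_span C x -> left_inv w -> left_span C (x * w).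
Proof.
move=> Cx wP; move: x Cx.
apply: (linear_span_map (T := w \o* idfun)); first exact: subspace_left_span.
move=> _ [a [v [Ca vP ->]]] /=; rewrite -mulrA.
by apply: left_spanM => //; apply: left_invM.
Qed.

Lemma base_homog a : homog 0 (base a).
Proof. by rewrite -base_range; exists a. Qed.

(** Leibniz rule d(a w) = (d a) w + a (d w): the form d w is left-invariant, and d a lies in C .
    Omega^inv since a |-> d a is covariant. *)
Lemma left_span_diff C x : right_coideal C -> left_span C x -> left_span C (d x).
Proof.
move=> CP; move: x.
apply: (linear_span_map (T := d)); first exact: subspace_left_span.
move=> _ [a [w [Ca wP ->]]] /=.
rewrite (diffM _ (base_homog a)) expr0 scale1r.
apply: subspaceD; first exact: subspace_left_span.
  apply: left_span_mulr => //.
  apply: (left_span_covariant (l := d \o base)) => // b /=.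
  by rewrite -coact_diff coact_base tmap_comp // => c y z; rewrite linearP.
by apply: left_spanM => //; apply: left_inv_diff.
Qed.

Lemma left_span_base_mul a x :
  left_span setT x -> left_span setT (base a * x).
Proof.
move: x.
apply: (linear_span_map (T := base a \*o idfun)); first exact: subspace_left_span.
by move=> _ [b [w [_ wP ->]]] /=; rewrite mulrA -rmorphM; apply: left_spanM.
Qed.

(** A product a w b v is handled by moving b to the left of w: the map b |-> w b is covariant
    because w is left-invariant. *)
Lemma left_span_mul x y :
  left_span setT x -> left_span setT y -> left_span setT (x * y).
Proof.
move=> xP yP; move: x xP.
apply: (linear_span_map (T := y \o* idfun)); first exact: subspace_left_span.
move=> _ [a [w [_ wP ->]]] /=; rewrite -mulrA; apply: left_span_base_mul.
move: y yP.
apply: (linear_span_map (T := w \*o idfun)); first exact: subspace_left_span.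
move=> _ [b [v [_ vP ->]]] /=; rewrite mulrA; apply: left_span_mulr => //.
apply: (left_span_covariant (l := w \*o base)) => //; last first.
  exact: right_coidealT.
move=> {}b /=; have [_ coactM] := coact_alg Omega.
rewrite coactM wP coact_base.
have bb (f : H -> Omega) : linear f -> bilinear_map (fun a b : H => a ⊗ f b).
  by move=> lf; apply: (@bilinear_pure _ _ _ _ _ idfun).
rewrite [coprod H b]tens_sum /tmap !tlift_sum_pure; last 2 first.
- by apply: (bb (fun b => w * base b)) => c y z; rewrite linearP mulrDr scalerAr.
- by apply: bb => c y z; rewrite linearP.
rewrite mulr_sumr; apply: eq_bigr => p _.
by rewrite -[LHS]/(tmul _ _) tmul_pure mul1r.
Qed.

(** Surjectivity of A ⊗ Omega^inv -> Omega. Degree 0 is the image of [base], higher degrees are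
    spanned by products a_0 da_1 ... da_k, and A . Omega^inv is closed under products and [d]. *)
Lemma left_spanT x : left_span setT x.
Proof.
have baseP a : left_span setT (base a).
  by rewrite -[base a]mulr1; apply: left_spanM => //; apply: left_inv1.
have [_ /(_ x)[] h1 _ _] := homog_direct Omega.
have [//|s [f [_ fP ->]]] := h1.
apply: subspace_sum => [|k _]; first exact: subspace_left_span.
case: k (f k) (fP k) => [|k] y.
  move=> y0; have [a _ <-] : range base y by rewrite base_range.
  exact: baseP.
rewrite homog_span //; apply: linear_span_min; first exact: subspace_left_span.
move=> _ [a0 [a ->]]; apply: left_span_mul => //.
elim/big_ind: _ => [|z t zP tP|i _].
- by have := baseP 1; rewrite rmorph1.
- exact: left_span_mul.
- by apply: left_span_diff => //; apply: right_coidealT.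
Qed.

End Calculus.

(** * The adjoint of the differential *)

Section HaarOrthogonality.
Context {K : numClosedFieldType} {H : hopfStarAlgebra K}.
Variable phi : H -> K.
Hypothesis phi_lin : scalar phi.

(** The GNS inner product of the Haar functional, linear in the first variable. *)
Definition haar_form (a b : H) : K := phi (star b * a).

Hypothesis phi_inv : forall a,
  tlift (fun b c => phi b *: c) (coprod H a) = phi a *: 1.
Hypothesis phi_ip : inner_product haar_form.

Definition haar_orth (C : set H) : set H :=
  [set a | forall b, C b -> haar_form a b = 0].

(** Write Delta a as a sum of a_1 ⊗ a_2. Invariance makes the sum of (a_1 | c) a_2 vanish for every
    c in [C], so the left legs may be replaced by their components orthogonal to [C]. *)
Lemma right_coideal_orth_corep n (u : 'I_n -> 'I_n -> H) : corep u ->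
  right_coideal
    (haar_orth (linear_span [set a | exists i j, a = u i j])).
Proof.
move=> uP; have [u1 u2 uD] := uP.
set X := [set a | _]; set C := linear_span X.
have bb := @bilinear_scale _ _ H phi phi_lin.
split=> [|a aC]; first exact: subspace_orth.
pose r := repr (coprod H a).
have aE : coprod H a = \sum_(p <- r) p.1 ⊗ p.2 by apply: tens_sum.
have Zu i j : \sum_(p <- r) haar_form p.1 (u i j) *: p.2 = 0.
  pose Z k := \sum_(p <- r) haar_form p.1 (u i k) *: p.2.
  (* invariance of [phi] at [u_im^* a], whose image under [phi] is [0] *)
  have uZ m : \sum_k star (u k m) * Z k = 0.
    have := phi_inv (star (u i m) * a).
    rewrite -[phi (_ * _)]/(haar_form _ _) aC; last first.
      by apply: mem_linear_span; exists i, m.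
    rewrite scale0r => h0; rewrite -[RHS]h0; have [_ ->] := coprod_alg H.
    rewrite coprod_star uD tstar_sum_pure aE mul_sum_pure (tlift_sum _ _ bb).
    apply: eq_bigr => k _; rewrite tlift_sum_pure // mulr_sumr.
    by apply: eq_bigr => p _; rewrite scalerAr.
  (* The relations u^* Z = 0 are inverted by u u^* = 1. *)
  rewrite -/(Z j) -(sum_delta Z j).
  under eq_bigr do rewrite -u1 mulr_suml.
  rewrite exchange_big big1 //= => m _.
  by under eq_bigr do rewrite -mulrA; rewrite -mulr_sumr uZ mulr0.
have ZC b : C b -> \sum_(p <- r) haar_form p.1 b *: p.2 = 0.
  apply: (linear_span_min
    (Y := [set b | \sum_(p <- r) haar_form p.1 b *: p.2 = 0])).
    split=> [/=|c x y /= x0 y0].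
      by rewrite big1 // => p _; rewrite (ip0r phi_ip) scale0r.
    under eq_bigr do rewrite (ipDr phi_ip) (ipZr phi_ip) scalerDl -scalerA.
    by rewrite big_split /= -scaler_sumr x0 y0 scaler0 addr0.
  by move=> _ [i [j ->]]; apply: Zu.
have [e eC eP] := orthogonal_projection phi_ip (entries_finite u).
exists [seq (p.1 - \sum_(v <- e) haar_form p.1 v *: v, p.2) | p <- r].
  by move=> _ /mapP[p _ ->]; apply: eP.
have pb := @pure_bilinear K H H.
have pB (x y z : H) : (x - y) ⊗ z = x ⊗ z - y ⊗ z.
  by rewrite (bilinDl pb) -scaleN1r (bilinZl pb) scaleN1r.
rewrite big_map aE; under [RHS]eq_bigr do rewrite pB pure_suml.
rewrite sumrB exchange_big /= big_seq [X in _ - X]big_seq.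
rewrite [X in _ - X]big1 ?subr0 // => v ve.
under eq_bigr do rewrite (bilinZl pb) -(bilinZr pb).
by rewrite -pure_sumr ZC ?(bilin0r pb) //; apply: eC.
Qed.

End HaarOrthogonality.

(** * Stability under the adjoint and eigenvectors of the Dirac operator *)

Section Adjoint.
Context {K : numClosedFieldType} {H : hopfStarAlgebra K}.
Context {Omega : starDiffCalculus H}.
Hypothesis corep_span : forall a : H, linear_span corep_entries a.
Variables (phi : H -> K) (phi_lin : scalar phi).
Hypothesis phi_inv : forall a,
  tlift (fun b c => phi b *: c) (coprod H a) = phi a *: 1.
Variables (q : Omega -> Omega -> K) (qP : inner_product q).
Hypothesis q_inv : left_invariant_form phi q.
Variable dstar : {linear Omega -> Omega}.
Hypothesis dstar_adj : is_adjoint q (diff Omega) dstar.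
Local Notation base := (base Omega).
Local Notation left_inv := (@left_inv K H Omega).
Local Notation left_span := (@left_span K H Omega).

Lemma haar_form_base a b : q (base a) (base b) = haar_form phi a b * q 1 1.
Proof. by have := @q_inv a b _ _ left_inv1 left_inv1; rewrite !mulr1. Qed.

Lemma q11_gt0 : 0 < q 1 1.
Proof. by case: qP => _ _; apply; apply: oner_neq0. Qed.

(** Up to the factor q(1, 1) > 0 this form is the restriction of [q] to degree 0, so faithfulness of
    [phi] on [H] is inherited from the definiteness of [q]. *)
Lemma haar_form_ip : inner_product (haar_form phi).
Proof.
have q0 := q11_gt0; have q11 : q 1 1 != 0 by rewrite gt_eqF.
have hE a b : haar_form phi a b = q (base a) (base b) / q 1 1.
  by rewrite haar_form_base mulfK.
split=> [y c a b|a b|a a0].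
- by rewrite /haar_form mulrDr -scalerAr phi_lin.
- rewrite !hE rmorphM fmorphV /= -!(ipC qP); congr (_ / _).
- rewrite hE divr_gt0 //; case: qP => _ _; apply.
  apply: contra a0 => /eqP ba; apply/eqP/(@base_inj _ _ Omega).
  by rewrite ba rmorph0.
Qed.

Section Corep.
Context {n : nat} {u : 'I_n -> 'I_n -> H} (uP : corep u).
Let C := linear_span [set a | exists i j, a = u i j].
Let C' := haar_orth phi C.

(** Left-invariance gives (a w | b v) = phi(b^* a) (w | v), whose first factor vanishes. *)
Lemma left_span_orth x y : left_span C x -> left_span C' y -> q y x = 0.
Proof.
move=> xP; move: y; apply: (linear_span_min (Y := [set y | q y x = 0])).
  split=> [|c y z /= y0 z0]; first exact: (ip0l qP).
  by rewrite (ipDl qP) (ipZl qP) y0 z0 mulr0 addr0.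
move=> _ [a [w [Ca wP ->]]] /=; move: x xP.
apply: (linear_span_min (Y := [set x | q (base a * w) x = 0])).
  split=> [|c y z /= y0 z0]; first exact: (ip0r qP).
  by rewrite (ipDr qP) (ipZr qP) y0 z0 mulr0 addr0.
move=> _ [b [v [Cb vP ->]]] /=.
by rewrite q_inv // -[phi _]/(haar_form phi a b) Ca // mul0r.
Qed.

(** In a w, the coefficient a is projected orthogonally onto the finite-dimensional space [C]. *)
Lemma left_span_split x :
  exists y z, [/\ left_span C y, left_span C' z & x = y + z].
Proof.
have SC := @subspace_left_span K H Omega.
apply: (linear_span_min (Y := [set x |
    exists y z, [/\ left_span C y, left_span C' z & x = y + z]]) _ _
    (left_spanT corep_span x)).
  split=> [|c _ _ [y [z [yP zP ->]]] [y' [z' [yP' zP' ->]]]].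
    by exists 0, 0; split; rewrite ?addr0 //; case: (SC C); case: (SC C').
  exists (c *: y + y'), (c *: z + z'); split.
  - by have [_ h] := SC C; apply: h.
  - by have [_ h] := SC C'; apply: h.
  - by rewrite scalerDr addrACA.
move=> _ [a [w [_ wP ->]]].
have [e eC eP] := orthogonal_projection haar_form_ip (entries_finite u).
pose b := \sum_(v <- e) haar_form phi a v *: v.
exists (base b * w), (base (a - b) * w); split.
- apply: left_spanM => //; apply: subspace_sum => [|v ve].
    exact: subspace_linear_span.
  by apply: subspaceZ; [apply: subspace_linear_span | apply: eC].
- by apply: left_spanM => // c; apply: eP.
- by rewrite -mulrDl -rmorphD addrC subrK.
Qed.

(** Let z be the component of d^* x in C' . Omega^inv. That space is stable under d and orthogonal
    to C . Omega^inv, so (z | z) = (z | d^* x) = (d z | x) = 0. *)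
Lemma left_span_adjoint x : left_span C x -> left_span C (dstar x).
Proof.
move=> xP; have [y [z [yP zP dx]]] := left_span_split (dstar x).
suff z0 : z = 0 by rewrite dx z0 addr0.
apply: (ip_eq0 qP).
have dz : left_span C' (diff Omega z).
  by apply: left_span_diff => //; apply: right_coideal_orth_corep => //;
     apply: haar_form_ip.
have : q z (dstar x) = 0 by rewrite -dstar_adj (left_span_orth xP).
by rewrite dx (ipDr qP) (left_span_orth yP) // add0r.
Qed.

Lemma left_span_finite : strongly_finite_dimensional Omega ->
  finite_dimensional (left_span C).
Proof.
move=> [s sE]; have [t tE] := entries_finite u.
exists [seq base a * w | a <- t, w <- s].
apply/seteqP; split; apply: linear_span_min; try exact: subspace_linear_span.
  move=> _ [a [w [Ca wP ->]]]; move: a Ca; rewrite /C tE.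
  apply: (linear_span_map (T := w \o* base)); first exact: subspace_linear_span.
  move=> a ta /=; move: w wP; rewrite sE.
  apply: (linear_span_map (T := base a \*o idfun)).
    exact: subspace_linear_span.
  by move=> w ws; apply: mem_linear_span; apply: allpairs_f.
move=> _ /allpairsP[[a w] [ta ws ->]] /=; apply: left_spanM.
  by rewrite /C tE; apply: mem_linear_span.
by rewrite sE; apply: mem_linear_span.
Qed.

End Corep.

Lemma adjoint_sym x y : q (dstar x) y = q x (diff Omega y).
Proof. by rewrite (ipC qP) -dstar_adj -(ipC qP). Qed.

Definition dirac_linear : {linear Omega -> Omega} := diff Omega \+ dstar.

Lemma dirac_sym x y : q (dirac_linear x) y = q x (dirac_linear y).
Proof. by rewrite /= (ipDl qP) (ipDr qP) dstar_adj adjoint_sym addrC. Qed.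

(** It suffices to treat u_ij w with w left-invariant. Its iterates under D remain in the
    finite-dimensional space C . Omega^inv, where C is the span of the entries of u. *)
Lemma eigensum_dirac : strongly_finite_dimensional Omega ->
  forall x, eigensum (dirac dstar) x.
Proof.
move=> fin x.
have sub := subspace_eigensum dirac_linear.
apply: (linear_span_min sub _ (left_spanT corep_span x)).
move=> _ [a [w [_ wP ->]]]; move: a (corep_span a).
apply: (linear_span_map (T := w \o* base)); first exact: sub.
move=> _ [n [u [uP [i [j ->]]]]] /=.
have [s sE] := left_span_finite (u := u) fin.
apply: (symmetric_eigensum qP dirac_sym (s := s)) => m; rewrite -sE.
elim: m => [|m IH] /=.
  by apply: left_spanM => //; apply: mem_linear_span; exists i, j.
apply: subspaceD; first exact: subspace_left_span.
  by apply: left_span_diff => //; apply: right_coideal_corep.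
exact: left_span_adjoint.
Qed.

End Adjoint.

(** * Hodge decomposition *)

(** With finitely many indices it is enough to consider families over all of [I]: a family over part
    of [I] is extended by 0. *)
Lemma finite_direct_sum (K : fieldType) (V : lmodType K) (I : finType)
    (X : I -> set V) (Y : set V) :
  (forall i, subspace (X i)) ->
  (forall y, Y y <-> exists x : I -> V,
     (forall i, X i (x i)) /\ y = \sum_i x i) ->
  (forall x : I -> V, (forall i, X i (x i)) -> \sum_i x i = 0 ->
     forall i, x i = 0) ->
  is_direct_sum X Y.
Proof.
move=> XV XY X0.
have extend (s : seq I) (x : I -> V) : uniq s -> (forall i, X i (x i)) ->
    exists x' : I -> V, [/\ forall i, X i (x' i),
      \sum_(i <- s) x i = \sum_i x' i & {in s, x =1 x'}].
  move=> us xX; exists (fun i => if i \in s then x i else 0); split=> [i||i /= ->//].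
    by case: ifP => // _; case: (XV i).
  by rewrite big_uniq // big_mkcond.
split=> // [y|s x us xX]; last first.
  have [x' [x'X -> xx']] := extend s x us xX.
  by move=> /X0 x'0 i si; rewrite xx' // x'0.
rewrite XY; split=> [[x [xX ->]]|[s [x [us xX ->]]]].
  by exists (index_enum I), x; split=> //; apply: index_enum_uniq.
by have [x' [x'X -> _]] := extend s x us xX; exists x'.
Qed.

Section Hodge.
Context {K : numClosedFieldType} {V : lmodType K}.
Variables (q : V -> V -> K) (qP : inner_product q).
Variables (d dstar D : {linear V -> V}).
Hypothesis dK : forall x, d (d x) = 0.
Hypothesis dstar_adj : forall x y, q (d x) y = q x (dstar y).
Hypothesis DE : forall x, D x = d x + dstar x.
Hypothesis D_eigensum : forall x, eigensum D x.

Let D_adj x y : q (dstar x) y = q x (d y).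
Proof. by rewrite (ipC qP) -dstar_adj -(ipC qP). Qed.

Let D_sym x y : q (D x) y = q x (D y).
Proof. by rewrite !DE (ipDl qP) (ipDr qP) dstar_adj D_adj addrC. Qed.

Lemma adjointK x : dstar (dstar x) = 0.
Proof.
by apply: (ip_nondeg qP) => y; rewrite D_adj D_adj dK (ip0r qP).
Qed.

Lemma orthogonal_ranges x y : q (d x) (dstar y) = 0.
Proof. by rewrite -dstar_adj dK (ip0l qP). Qed.

(** If D x = 0 then d x = - d^* x, while the ranges of d and d^* are orthogonal; hence (d x | d x) =
    0. *)
Lemma kernel_dirac : kernel D = kernel d `&` kernel dstar.
Proof.
apply/seteqP; split=> x; rewrite /kernel /= DE; last first.
  by move=> [-> ->]; rewrite addr0.
move=> Dx; have dx : d x = 0.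
  apply: (ip_eq0 qP); have /eqP := Dx; rewrite addr_eq0 => /eqP {2}->.
  by rewrite -scaleN1r (ipZr qP) orthogonal_ranges mulr0.
by move: Dx; rewrite dx add0r.
Qed.

(** By symmetry (D x | D x) = (x | D (D x)). *)
Lemma kernel_dirac2 : kernel (fun x => D (D x)) = kernel D.
Proof.
apply/seteqP; split=> x; rewrite /kernel /= => Dx; last by rewrite Dx linear0.
by apply: (ip_eq0 qP); rewrite D_sym Dx (ip0r qP).
Qed.

Lemma eigensum_dirac2 x : eigensum (fun x => D (D x)) x.
Proof.
have [s sD ->] := D_eigensum x.
exists [seq (p.1 ^+ 2, p.2) | p <- s]; last by rewrite big_map.
move=> _ /mapP[p /sD Dp ->] /=.
by rewrite Dp linearZ /= Dp scalerA.
Qed.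

(** This rests on D^2 - r^2 = (D - r)(D + r). The index [true] carries the eigenvalue -r. *)
Lemma eigenspace_dirac2 (r : K) : r != 0 ->
  is_direct_sum
    (fun b : bool => kernel (fun w => if b then D w + r *: w else D w - r *: w))
    (kernel (fun w => D (D w) - r ^+ 2 *: w)).
Proof.
move=> r0; pose sg (b : bool) : K := if b then - r else r.
have sg0 b : sg b != 0 by rewrite /sg; case: b; rewrite ?oppr_eq0.
have sg2 b : r ^+ 2 = sg b ^+ 2 by rewrite /sg; case: b; rewrite ?sqrrN.
have kE b : kernel (fun w => if b then D w + r *: w else D w - r *: w) =
    [set w | D w = sg b *: w].
  apply/seteqP; split=> w; case: b => /=; rewrite /kernel /sg /= ?scaleNr.
  - by move/eqP; rewrite addr_eq0 => /eqP.
  - by move/eqP; rewrite subr_eq0 => /eqP.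
  - by move=> ->; rewrite addNr.
  - by move=> ->; rewrite subrr.
have two : (2 : K) != 0 by rewrite pnatr_eq0.
apply: finite_direct_sum => [b|y|x xD].
- rewrite kE; split=> [/=|c x y /= xE yE]; first by rewrite linear0 scaler0.
  by rewrite linearP /= xE yE scalerDr !scalerA mulrC.
- split=> [/eqP|[x [xD ->]]].
  + rewrite subr_eq0 => /eqP DDy.
    (* The component of [y] at the eigenvalue s = [sg b] is half of y + s^-1 D y: as D^2 y = s^2 y,
       [D] multiplies it by s, and the opposite signs make the two components add up to [y]. *)
    exists (fun b => 2^-1 *: (y + (sg b)^-1 *: D y)); split=> [b|]; last first.
      rewrite big_bool /= -scalerDr addrACA /sg invrN scaleNr addNr addr0.
      by rewrite -mulr2n -scaler_nat scalerA mulVf // scale1r.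
    rewrite kE /= linearZ linearD linearZ /= DDy (sg2 b).
    rewrite [_^-1 *: (_ *: y)]scalerA expr2 mulKf // [RHS]scalerA [sg b * _]mulrC.
    rewrite -[RHS]scalerA; congr (_ *: _).
    by rewrite scalerDr scalerA mulfV // scale1r addrC.
  + apply/eqP; rewrite subr_eq0 big_bool /=.
    have DD b : D (D (x b)) = r ^+ 2 *: x b.
      have := xD b; rewrite kE /= => xb.
      by rewrite xb linearZ /= xb scalerA -expr2 -sg2.
    by rewrite !linearD /= !DD.
- rewrite big_bool /= => /eqP; rewrite addr_eq0 => /eqP xt.
  (* [x false] is the negative of [x true], so [D] acts on it both as r and as -r; hence 2 r kills
     it. *)
  have xf0 : x false = 0.
    have xE b : D (x b) = sg b *: x b by have := xD b; rewrite kE.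
    have := xE true; rewrite xt linearN xE /sg /= scaleNr scalerN opprK => /eqP.
    rewrite eq_sym -addr_eq0 -mulr2n -scaler_nat !scaler_eq0 (negPf two).
    by rewrite (negPf r0) /= => /eqP.
  by case; rewrite ?xt xf0 ?oppr0.
Qed.

(** A vector p with D p = t p lies in the kernel if t = 0, and otherwise t p = D p = d p + d^* p
    gives p = t^-1 (d d^* p + d^* d p) after scaling. Such vectors span, and directness follows from
    orthogonality. *)
Lemma hodge_decomposition :
  is_orthogonal_sum q
    (fun i : 'I_3 => nth set0
       [:: kernel (fun x => D (D x)); range d; range dstar] i) setT.
Proof.
have kP x : kernel (fun x => D (D x)) x -> d x = 0 /\ dstar x = 0.
  by rewrite kernel_dirac2 kernel_dirac.
have orth (i j : 'I_3) x y : i != j ->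
   nth set0 [:: kernel (fun x => D (D x)); range d; range dstar] i x ->
   nth set0 [:: kernel (fun x => D (D x)); range d; range dstar] j y -> q x y = 0.
  wlog ij : i j x y / (i < j)%N => [H nij xi yj|].
    move: (nij); rewrite neq_ltn => /orP[ij|ji]; first exact: (H i j).
    by rewrite (ipC qP) (H j i) ?rmorph0 // eq_sym.
  move=> _; case: i j ij => [[|[|[|i]]] // ?] [[|[|[|j]]] // ?] //= _.
  - by move=> /kP[_ dx] [z _ <-]; rewrite -D_adj dx (ip0l qP).
  - by move=> /kP[dx _] [z _ <-]; rewrite -dstar_adj dx (ip0l qP).
  - by move=> [z _ <-] [w _ <-]; apply: orthogonal_ranges.
split; last exact: orth.
apply: finite_direct_sum => [i|y|x xX x0 i].
- case: i => [[|[|[|i]]] // ?] /=.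
  + split=> [|c x y]; rewrite /kernel /=; first by rewrite !linear0.
    by move=> xk yk; rewrite !linearP /= xk yk scaler0 addr0.
  + split=> [|c _ _ [x _ <-] [y _ <-]]; first by exists 0; rewrite ?linear0.
    by exists (c *: x + y); rewrite ?linearP.
  + split=> [|c _ _ [x _ <-] [y _ <-]]; first by exists 0; rewrite ?linear0.
    by exists (c *: x + y); rewrite ?linearP.
- split=> // _.
  suff [a [b [c [ak ->]]]] : exists a b c,
      kernel (fun x => D (D x)) a /\ y = a + d b + dstar c.
    exists (fun i : 'I_3 => nth 0 [:: a; d b; dstar c] i); split.
      by case=> [[|[|[|i]]] // ?] /=; [exists b | exists c].
    by rewrite !big_ord_recl big_ord0 /= addr0 addrA.
  have [s sD ->] := eigensum_dirac2 y.
  elim: s sD => [|[t p] s IH] sD.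
    exists 0, 0, 0; rewrite big_nil !linear0 !addr0; split=> //.
    by rewrite /kernel /= !linear0.
  have [|a [b [c [ak sE]]]] := IH.
    by move=> r rs; apply: sD; rewrite inE rs orbT.
  have /= pE := sD _ (mem_head _ _).
  rewrite big_cons sE /=; have [t0|t0] := eqVneq t 0.
    exists (p + a), b, c; rewrite !addrA; split=> //.
    by rewrite /kernel /= !linearD /= ak pE t0 scale0r addr0.
  exists a, (t^-1 *: dstar p + b), (t^-1 *: d p + c); split=> //.
  have {1}-> : p = t^-1 *: d (dstar p) + t^-1 *: dstar (d p).
    rewrite -scalerDr; apply: (scalerI t0); rewrite scalerA mulfV // scale1r.
    by rewrite -pE !DE !linearD dK add0r adjointK addr0.
  by rewrite !linearP /= addrACA [X in X + _]addrCA !addrA.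
(* Pairing the vanishing sum with [x i] leaves only (x_i | x_i). *)
- apply: (ip_eq0 qP); have := ip0l qP (x i); rewrite -x0 (ip_suml qP).
  rewrite (bigD1 i) //= big1 ?addr0 // => j ji.
  by apply: (orth j i); [|apply: xX|apply: xX].
Qed.

End Hodge.

(** * Compact quantum groups *)

(** Expanding the left legs in an orthonormal frame turns the sum into one of terms v ⊗ w_v, where
    w_v is the slice against v and vanishes by hypothesis. *)
Lemma pure_sum_eq0 (K : numClosedFieldType) (V W : lmodType K)
    (q : V -> V -> K) (r : seq (V * W)) : inner_product q ->
  (forall v, \sum_(p <- r) q p.1 v *: p.2 = 0) ->
  \sum_(p <- r) p.1 ⊗ p.2 = 0.
Proof.
move=> qP r0; have pb := @pure_bilinear K V W.
have [e _ eP] := orthogonal_frame qP [seq p.1 | p <- r].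
rewrite big_seq.
under eq_bigr => p pr.
  rewrite [X in X ⊗ _]eP; last by apply: mem_linear_span; apply: map_f.
  rewrite pure_suml.
  under eq_bigr do rewrite (bilinZl pb) -(bilinZr pb).
  over.
rewrite -big_seq exchange_big big1 //= => v _.
by rewrite -pure_sumr r0 (bilin0r pb).
Qed.

(** * The Hopf algebra inside the compact quantum group *)

Section AssociatedHopf.
Context {R : realType} {G : compactQuantumGroup R} {A : associatedHopf G}.
Context {h : G -> complex R} (haar_h : is_haar_state h).
Local Notation incl := (assoc_incl A).
Local Notation phi := (fun a => h (incl a)).

Let h_lin : scalar h. Proof. by case: haar_h => -[]. Qed.

Lemma haar_scalar : scalar phi.
Proof. by move=> c a b; rewrite linearP h_lin. Qed.

Lemma cten_incl_bilinear : bilinear_map (fun b c => cten (incl b) (incl c)).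
Proof.
have [[b1 b2] _ _ _ _] := cten_min G.
by split=> [v c x y|u c x y]; rewrite linearP; [apply: b1 | apply: b2].
Qed.

(** The invariance of [h] on [G] restricts along [incl], which is injective and intertwines the
    coproducts. *)
Lemma haar_invariant a :
  tlift (fun b c => phi b *: c) (coprod A a) = phi a *: 1.
Proof.
have [_ [F [Flin _ FE] Fh] _] := haar_h.
have bb := @bilinear_scale _ A A phi haar_scalar.
have F0 : F 0 = 0.
  by have := Flin (-1) 0 0; rewrite scaler0 addr0 scaleN1r addNr.
have FD : {morph F : x y / x + y}.
  by move=> x y; have := Flin 1 x y; rewrite !scale1r.
apply: (@assoc_incl_inj _ _ A); rewrite linearZ /= rmorph1 -Fh.
rewrite -assoc_incl_coprod [coprod A a]tens_sum.
rewrite (tlift_sum_pure _ _ _ bb) (tlift_sum_pure _ _ _ cten_incl_bilinear).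
rewrite linear_sum (big_morph F FD F0); apply: eq_bigr => p _.
by rewrite linearZ FE.
Qed.

Hypothesis phi_ip : inner_product (haar_form phi).

(* The C*-norm gives injectivity on [G ⊗ G]; the functionals [h (v^* .)] then
   separate the points of [A ⊗ A] in the image. *)
Lemma cten_incl_inj (x : tens A A) :
  tlift (fun b c => cten (incl b) (incl c)) x = 0 -> x = 0.
Proof.
have [jb _ _ [[p0 _ pZ _ _] _] _] := cten_min G.
rewrite [x]tens_sum (tlift_sum_pure _ _ _ cten_incl_bilinear) => x0.
have x1 : \sum_(p <- repr x) incl p.1 ⊗ incl p.2 = 0 :> tens G G.
  apply: (p0 _).2; rewrite (tlift_sum_pure _ _ _ jb) x0.
  have := pZ 0 0; rewrite scaler0 normr0 mul0r.
  by rewrite (tlift_zero jb).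
apply: (pure_sum_eq0 phi_ip) => v; apply: (@assoc_incl_inj _ _ A).
have hb : bilinear_map (fun g g' : G => h (star (incl v) * g) *: g').
  apply: (@bilinear_scale _ G G (fun g => h (star (incl v) * g))) => c a b.
  by rewrite mulrDr -scalerAr h_lin.
have := congr1 (tlift (fun g g' : G => h (star (incl v) * g) *: g')) x1.
rewrite (tlift_sum_pure _ _ _ hb) (tlift_zero hb) linear0 => <-.
rewrite linear_sum; apply: eq_bigr => p _.
by rewrite linearZ /= /haar_form rmorphM /= assoc_incl_star.
Qed.

(** Matrix elements of [G] are pulled back along [incl]. Their preimages satisfy the unitarity
    relations by injectivity of [incl], and the coproduct formula by injectivity on the tensor
    square. *)
Lemma corep_entries_span (a : A) : linear_span corep_entries a.
Proof.
pose Y := [set y | exists2 b, incl b = y & linear_span corep_entries b].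
suff : Y (incl a) by move=> [b /(@assoc_incl_inj _ _ A) ->].
have ME y : linear_span (@matrix_elements R G) y -> exists b, incl b = y.
  by rewrite -(assoc_incl_range A) => -[b _ <-]; exists b.
have : linear_span (@matrix_elements R G) (incl a).
  by rewrite -(assoc_incl_range A); exists a.
apply: linear_span_min.
  split=> [|c _ _ [x <- xP] [y <- yP]].
    exists 0; first exact: linear0.
    by case: (subspace_linear_span (@corep_entries _ A)).
  exists (c *: x + y); first by rewrite linearP.
  by have [_ S] := subspace_linear_span (@corep_entries _ A); apply: S.
move=> _ [n [u [uP uirr [i [j ->]]]]].
have entry (k : 'I_n * 'I_n) : exists b, incl b = u k.1 k.2.
  apply: ME; apply: mem_linear_span.
  by exists n, u; split=> //; exists k.1, k.2.
have [v vE] := choice entry.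
exists (v (i, j)) => //; apply: mem_linear_span.
exists n, (fun k l => v (k, l)); split; last by exists i, j.
have [u1 u2 uD] := uP; split=> k l.
- apply: (@assoc_incl_inj _ _ A); rewrite rmorph_nat linear_sum.
  move/matrixP/(_ k l): u1; rewrite !mxE => <-; apply: eq_bigr => m _ /=.
  by rewrite rmorphM /= assoc_incl_star !vE mxE.
- apply: (@assoc_incl_inj _ _ A); rewrite rmorph_nat linear_sum.
  move/matrixP/(_ k l): u2; rewrite !mxE => <-; apply: eq_bigr => m _ /=.
  by rewrite rmorphM /= assoc_incl_star !vE mxE.
- apply/eqP; rewrite -subr_eq0; apply/eqP/cten_incl_inj.
  have lin := tlift_linear cten_incl_bilinear.
  rewrite -scaleN1r addrC lin assoc_incl_coprod vE uD scaleN1r.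
  rewrite (tlift_sum_pure _ _ _ cten_incl_bilinear).
  by under eq_bigr do rewrite !vE; rewrite addNr.
Qed.

End AssociatedHopf.

(** * Spectral and Hodge decompositions of the calculus *)

Local Open Scope complex_scope.

Theorem theorem4p1 (R : realType) (G : compactQuantumGroup R)
    (A : associatedHopf G) (h : G -> R[i]) (haar_h : is_haar_state h)
    (Omega : starDiffCalculus A)
    (Omega_fin : strongly_finite_dimensional Omega)
    (ip : {dot Omega for Num.conj})
    (ip_graded : graded_form ip)
    (ip_inv : left_invariant_form (fun a => h (assoc_incl A a)) ip)
    (dstar : {linear Omega -> Omega})
    (dstar_adj : is_adjoint ip (diff Omega) dstar) :
  let d : Omega -> Omega := diff Omega in
  let D := dirac dstar in
  let nabla := laplacian dstar in
  [/\ diagonalisable D /\ diagonalisable nabla,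
      [/\ kernel nabla = kernel D,
          kernel D = kernel d `&` kernel dstar &
          forall t : R[i], 0 < t -> is_eigenvalue nabla t ->
            is_direct_sum
              (fun b : bool => kernel (fun w =>
                 if b then D w + sqrtC t *: w else D w - sqrtC t *: w))
              (kernel (fun w => nabla w - t *: w))] &
      is_orthogonal_sum ip
        (fun i : 'I_3 => nth set0 [:: kernel nabla; range d; range dstar] i)
        setT].
Proof.
move=> d D nabla.
have qP : inner_product ip.
  split=> [y c x z|x y|x x0].
  - by rewrite linearPl.
  - by rewrite hermC expr0 mul1r.
  - by rewrite dnorm_gt0.
(* Definiteness of [ip] makes [h] faithful on [A], from which the spanning by corepresentation
   entries is derived. *)
have phi_ip := haar_form_ip (haar_scalar (A := A) haar_h) qP ip_inv.
have span := corep_entries_span haar_h phi_ip.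
have Deig := eigensum_dirac span (haar_scalar haar_h) (haar_invariant haar_h)
  qP ip_inv dstar_adj Omega_fin.
have DE x : dirac_linear dstar x = diff Omega x + dstar x by [].
have dK := @diffK _ Omega.
split.
- split; apply: diagonalisable_eigensum => //.
  exact: (eigensum_dirac2 (D := dirac_linear dstar)).
- split.
  + exact: (kernel_dirac2 qP dstar_adj DE).
  + exact: (kernel_dirac qP dK dstar_adj DE).
  (* [t] is written as the square of [sqrtC t], which is nonzero as t > 0. *)
  + move=> t t0 _; rewrite -[t in kernel (fun w => nabla w - t *: w)]sqrtCK.
    apply: (eigenspace_dirac2 (dirac_linear dstar)).
    by rewrite sqrtC_eq0 gt_eqF.
- exact: (hodge_decomposition qP dK dstar_adj DE).
Qed.
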